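(* Let $n\ge1$, let $J:\mathbb{R}^n\to\mathbb{R}$ be locally Lipschitz, let $a>0$, and let $\hat\omega_1,\dots,\hat\omega_n>0$ be rationally independent, i.e. $\ell^\top\hat\omega\ne0$ for every $\ell\in\mathbb{Q}^n\setminus\{0\}$, where $\hat\omega=(\hat\omega_1,\dots,\hat\omega_n)^\top$. For $i=1,\dots,n$ define $$F_i(x,\theta)=-\frac{2^n}{a}J\bigl(x+a\sin\theta\bigr)\sin\theta_i\prod_{j\ne i}\cos^2\theta_j,\qquad x,\theta\in\mathbb{R}^n,$$ and $F=(F_1,\dots,F_n)^\top$. Define $$J_a(x)=\int_{[-1,1]^n}J(x+au)\kappa(u)\,\mathrm{d}u,\qquad \kappa(u)=\left(\frac2\pi\right)^n\prod_{j=1}^n\sqrt{1-u_j^2}.$$ Then $J_a$ is differentiable, and for every $z\in\mathbb{R}^n$ and every $\tau_0\in\mathbb{R}$ the limit $$\bar F(z)=\lim_{T\to\infty}\frac1T\int_{\tau_0}^{\tau_0+T}F(z,\hat\omega\tau)\,\mathrm{d}\tau$$ exists and satisfies $$\bar F(z)=-\int_{[-1,1]^n}\nabla J(z+au)\kappa(u)\,\mathrm{d}u=-\nabla J_a(z),$$ where $\nabla J$ is understood almost everywhere.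
   Context: Here $\sin\theta=(\sin\theta_1,\dots,\sin\theta_n)^\top$ componentwise. The function $F$ is the right-hand side in fast time $\tau=\omega t$, with $\varepsilon=k/\omega$, of the extremum seeking law $\dot{\hat x}=-kJ(\hat x+S(t))M(t)$ with $S_i(t)=a\sin(\omega\hat\omega_i t)$ and $M_i(t)=\frac{2^n}{a}\sin(\omega\hat\omega_i t)\prod_{j\ne i}\cos^2(\omega\hat\omega_j t)$; that is, $\frac{\mathrm{d}\hat x}{\mathrm{d}\tau}=\varepsilon F(\hat x,\hat\omega\tau)$. By Rademacher's theorem $\nabla J$ exists almost everywhere (Lebesgue measure). *)

(* Defs.v *)
From HB Require Import structures.
From mathcomp Require Import all_boot all_order all_algebra.
From mathcomp Require Import all_classical all_reals all_analysis.

Set Implicit Arguments.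
Unset Strict Implicit.
Unset Printing Implicit Defensive.

Import Order.TTheory GRing.Theory Num.Theory.
Import numFieldNormedType.Exports.

Local Open Scope classical_set_scope.
Local Open Scope ring_scope.

(* R^n is 'rV[R]_n for its normed space structure (sup norm) and
   n.-tuple (measurableTypeR R) for its Borel sigma-algebra, which is the one
   generated by the coordinates; rV_of_tuple is the identification. *)
Definition rV_of_tuple (R : realType) (n : nat)
    (u : n.-tuple (measurableTypeR R)) : 'rV[R]_n :=
  \row_(i < n) tnth u i.

Definition tuple_cons (R : realType) (n : nat)
    (p : measurableTypeR R * n.-tuple (measurableTypeR R)) :
  n.+1.-tuple (measurableTypeR R) := [tuple of p.1 :: p.2].

Lemma measurable_tuple_cons (R : realType) (n : nat) :
  measurable_fun [set: measurableTypeR R * n.-tuple (measurableTypeR R)]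
    (@tuple_cons R n).
Proof. exact: measurable_cons measurable_fst measurable_snd. Qed.

Section lebesgue_cons.
Context (R : realType) (n : nat).
Variable mu : {measure set (n.-tuple (measurableTypeR R)) -> \bar R}.

(* Image of the product of the one-dimensional Lebesgue measure with mu under
   R * R^n = R^(n+1). *)
Definition lebesgue_cons : set (n.+1.-tuple (measurableTypeR R)) -> \bar R :=
  pushforward (@lebesgue_measure R \x^ mu)%E (@tuple_cons R n).

Let mcons := @measurable_tuple_cons R n.

Let lebesgue_cons0 : lebesgue_cons set0 = 0%E.
Proof. exact: measure0. Qed.

Let lebesgue_cons_ge0 A : (0 <= lebesgue_cons A)%E.
Proof. exact: measure_ge0. Qed.

Let lebesgue_cons_sigma_additive : semi_sigma_additive lebesgue_cons.
Proof. exact: measure_semi_sigma_additive. Qed.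

HB.instance Definition _ := isMeasure.Build _ _ _ lebesgue_cons
  lebesgue_cons0 lebesgue_cons_ge0 lebesgue_cons_sigma_additive.

End lebesgue_cons.

(* Lebesgue measure on R^n. *)
Fixpoint lebesgue_tuple (R : realType) (n : nat) :
    {measure set (n.-tuple (measurableTypeR R)) -> \bar R} :=
  match n with
  | 0 => dirac [tuple]
  | m.+1 => lebesgue_cons (lebesgue_tuple R m)
  end.

(* The cube [-1, 1]^n. *)
Definition cube (R : realType) (n : nat) : set (n.-tuple (measurableTypeR R)) :=
  [set u | forall i : 'I_n, -1 <= (tnth u i : R) <= 1].

Section extremum_seeking.
Context (R : realType) (n : nat).
Implicit Types (J : 'rV[R]_n -> R) (a : R) (x theta w : 'rV[R]_n).

Definition rationally_independent w : Prop :=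
  forall l : 'rV[rat]_n, l != 0 -> \sum_(i < n) ratr (l 0 i) * w 0 i != 0.

Definition unit_vec (i : 'I_n) : 'rV[R]_n := delta_mx 0 i.

(* The vector of partial derivatives; 'D_v J x is a junk value at the points
   where J is not derivable along v. *)
Definition grad J x : 'rV[R]_n := \row_(i < n) 'D_(unit_vec i) J x.

Definition esF J a x theta : 'rV[R]_n :=
  \row_(i < n) (- (2 ^+ n / a) * J (x + a *: map_mx sin theta)
                * sin (theta 0 i)
                * \prod_(j < n | j != i) cos (theta 0 j) ^+ 2).

Definition kappa (u : 'rV[R]_n) : R :=
  (2 / pi) ^+ n * \prod_(j < n) Num.sqrt (1 - u 0 j ^+ 2).

Definition Ja J a x : R :=
  \int[lebesgue_tuple R n]_(u in @cube R n)
    (J (x + a *: rV_of_tuple u) * kappa (rV_of_tuple u)).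

(* (1 / T) * \int_tau0^(tau0 + T) F(z, w tau) dtau, componentwise. *)
Definition time_average J a w (z : 'rV[R]_n) (tau0 T : R) : 'rV[R]_n :=
  \row_(i < n) (T^-1 * \int[lebesgue_measure]_(tau in `[tau0, tau0 + T])
                         esF J a z (tau *: w) 0 i).

(* \int_{[-1,1]^n} (grad J)(z + a u) kappa(u) du, componentwise. *)
Definition smoothed_grad J a (z : 'rV[R]_n) : 'rV[R]_n :=
  \row_(i < n) \int[lebesgue_tuple R n]_(u in @cube R n)
    (grad J (z + a *: rV_of_tuple u) 0 i * kappa (rV_of_tuple u)).

End extremum_seeking.

(* Main.v *)
(** Product polynomials p(x) = \sum_c c \prod_j p_{c,j}(x_j) approximate J
    uniformly on balls (Bernstein). For such a polynomial the time average of F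
    factorizes, by rational independence, into means of one-variable polynomials
    in sin t, and integration by parts identifies it with - grad J_a. The maps
    J |-> F and J |-> J_a are bounded for the sup norm, so the averages converge
    for every locally Lipschitz J, to a function - G that is again locally
    Lipschitz; passing to the limit in the mean value theorem gives
    |J_a(x + h) - J_a(x) - G(x).h| <= C |h|^2, hence grad J_a = G.

    The weak formula for grad J_a is dominated convergence of difference
    quotients along a coordinate. It needs Rademacher's theorem only for partial
    derivatives, which reduces by Fubini to one variable: there J plus a linear
    function is nondecreasing, its Stieltjes measure is dominated by Lebesgue
    measure, and the Lebesgue differentiation theorem applies to the density. *)
Require Import Defs.
From HB Require Import structures.
From mathcomp Require Import all_boot all_order all_algebra.
From mathcomp Require Import all_classical all_reals all_analysis.
From mathcomp Require Import measurable_realfun ring lra.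

Set Implicit Arguments.
Unset Strict Implicit.
Unset Printing Implicit Defensive.

Import Order.TTheory GRing.Theory Num.Theory.
Import numFieldNormedType.Exports.

Local Open Scope classical_set_scope.
Local Open Scope ring_scope.

(** The density [kappa] comes from the dither. For t uniform on a period, sin t has density 1 / (pi
    sqrt(1 - u^2)); a factor cos^2 t turns it into sqrt(1 - u^2) / pi, which is half a semicircle
    density. The single factor sin t becomes, after integration by parts, the same weight against a
    times a derivative. The n halves and this a cancel the constant 2^n / a of F. The obstacle is
    that approximation in the sup norm does not control derivatives, and J need not have a gradient
    at every point. Hence only undifferentiated objects, the time averages and J_a, are compared
    with those of polynomials. The weak gradient formula is matched at the end: the difference
    quotients of J_a converge to its partial derivative by differentiability and to the integral of
    grad J by dominated convergence. *)

(** * Local Lipschitz continuity and the sup norm on R^n *)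

Definition lipschitz_on_balls (R : realType) (n : nat) (J : 'rV[R]_n -> R) :=
  forall M : R, exists2 L : R, 0 <= L & forall x y : 'rV[R]_n,
    `|x| <= M -> `|y| <= M -> `|J x - J y| <= L * `|x - y|.

(** The hypothesis provides a constant near every pair of points, off-diagonal pairs included, so
    compactness of [K * K], not only of [K], gives one constant for the whole ball. *)
Lemma locally_lipschitz_on_balls (R : realType) (n : nat) (J : 'rV[R]_n -> R) :
  [locally [lipschitz J x | x in [set: 'rV[R]_n]]] -> lipschitz_on_balls J.
Proof.
move=> lipJ M.
pose K := [set x : 'rV[R]_n | `|x| <= M].
have cK : compact K.
  apply: bounded_closed_compact.
    exists M; split; first exact: num_real.
    by move=> N MN x /= /le_trans; apply; exact: ltW.
  apply: (@preimage_closed _ _ (fun x : 'rV[R]_n => `|x|) [set r | r <= M]).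
    by move=> x _; exact: norm_continuous.
  exact: closed_le.
have cKK : compact (K `*` K) by exact: compact_setX.
have : \forall L \near +oo, K `*` K `<=`
    [set p : 'rV[R]_n * 'rV[R]_n | `|J p.1 - J p.2| <= L * `|p.1 - p.2|].
  apply: (compact_near_coveringP _).1 => //= p _.
  have [M0 [_ hM0]] := lipJ p (conj Logic.I Logic.I).
  have {}hM0 := hM0 (M0 + 1) (ltac:(by rewrite ltrDl)).
  exists ([set q : 'rV[R]_n * 'rV[R]_n | `|J q.1 - J q.2| <= (M0 + 1) * `|q.1 - q.2|],
          [set L | M0 + 1 < L]).
    split => /=; last by exists (M0 + 1); split => //; exact: num_real.
    by move: hM0; rewrite /dominated_by /within /=; apply: filterS => q; apply; split.
  move=> [q L] [/= hq hL]; apply: (le_trans hq).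
  by rewrite ler_wpM2r// ltW.
move=> [L0 [_ hL]].
exists (Num.max 0 (L0 + 1)) => [|x y Mx My]; first by rewrite le_max lexx.
by apply: (hL _ _ (x, y)) => //=; rewrite lt_max ltrDl ltr01 orbT.
Qed.

Lemma mx_norm_coord (R : realType) (n : nat) (x : 'rV[R]_n) (i : 'I_n) :
  `|x 0 i| <= `|x|.
Proof. by rewrite [leRHS]mx_normrE (le_bigmax _ _ (0, i)). Qed.

Lemma mx_norm_le_sum (R : realType) (n : nat) (x : 'rV[R]_n) :
  `|x| <= \sum_i `|x 0 i|.
Proof.
rewrite [leLHS]mx_normrE; apply/bigmax_leP; split=> [|[i j] _ /=].
  by apply: sumr_ge0.
by rewrite ord1 (bigD1 j)//= lerDl sumr_ge0.
Qed.

Lemma mx_norm_le (R : realType) (n : nat) (x : 'rV[R]_n) (M : R) : 0 <= M ->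
  (forall i, `|x 0 i| <= M) -> `|x| <= M.
Proof.
move=> M0 xM; rewrite [leLHS]mx_normrE; apply/bigmax_leP; split=> // -[i j] _ /=.
by rewrite ord1.
Qed.

(** * Bernstein polynomials and uniform approximation by product polynomials *)

Section bernstein.
Context {R : realType}.

Definition bernstein (N k : nat) : {poly R} :=
  'C(N, k)%:R *: ('X^k * (1 - 'X) ^+ (N - k)).

Let bernsteinE N k (t : R) :
  (bernstein N k).[t] = 'C(N, k)%:R * (t ^+ k * (1 - t) ^+ (N - k)).
Proof. by rewrite /bernstein !hornerE. Qed.

Lemma bernstein_ge0 N k (t : R) : 0 <= t <= 1 -> 0 <= (bernstein N k).[t].
Proof.
by move=> /andP[t0 t1]; rewrite bernsteinE !mulr_ge0// exprn_ge0// subr_ge0.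
Qed.

(** Conditioning a binomial variable on one of its N + 1 trials; on coefficients this is Pascal's
    rule. *)
Lemma bernstein_sumS N (g : nat -> R) (t : R) :
  \sum_(k < N.+2) (bernstein N.+1 k).[t] * g k =
  t * (\sum_(k < N.+1) (bernstein N k).[t] * g k.+1) +
  (1 - t) * (\sum_(k < N.+1) (bernstein N k).[t] * g k).
Proof.
rewrite big_ord_recl /= [in X in (1 - t) * X]big_ord_recl /= mulrDr.
rewrite !bernsteinE !bin0 !expr0 !subn0 exprS.
rewrite addrCA; congr (_ + _); first by ring.
transitivity (\sum_(k < N.+1) (t * ((bernstein N k).[t] * g k.+1) +
    'C(N, k.+1)%:R * (t ^+ k.+1 * (1 - t) ^+ (N - k)) * g k.+1)).
  apply: eq_bigr => k _; rewrite !bernsteinE /bump/= add1n subSS binS natrD exprS.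
  by ring.
rewrite big_split /= -mulr_sumr; congr (_ + _).
rewrite big_ord_recr /= bin_small// mul0r mul0r addr0 mulr_sumr.
apply: eq_bigr => k _; rewrite bernsteinE /bump/= add1n.
by rewrite -(@subnSK k N)// [(1 - t) ^+ _.+1]exprS; ring.
Qed.

(** A general quadratic is kept because the induction replaces k by k + 1, which mixes the three
    coefficients. The moments of order 0, 1 and 2 are all read off this identity. *)
Lemma bernstein_moments N (a b c t : R) :
  \sum_(k < N.+1) (bernstein N k).[t] * (a * k%:R ^+ 2 + b * k%:R + c) =
  a * (N%:R * t * (1 - t) + (N%:R * t) ^+ 2) + b * (N%:R * t) + c.
Proof.
elim: N a b c => [|N IH] a b c.
  by rewrite big_ord_recl big_ord0 bernsteinE /= bin0 !expr0; ring.
rewrite (bernstein_sumS _ (fun k => a * k%:R ^+ 2 + b * k%:R + c)) IH.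
under eq_bigr => k _.
  rewrite (_ : a * k.+1%:R ^+ 2 + b * k.+1%:R + c =
    a * k%:R ^+ 2 + (2 * a + b) * k%:R + (a + b + c)); last by rewrite -natr1; ring.
  over.
by rewrite IH -natr1; ring.
Qed.

Lemma sum_bernstein N (t : R) : \sum_(k < N.+1) (bernstein N k).[t] = 1.
Proof.
transitivity (\sum_(k < N.+1) (bernstein N k).[t] * (0 * k%:R ^+ 2 + 0 * k%:R + 1)).
  by apply: eq_bigr => k _; ring.
by rewrite bernstein_moments; ring.
Qed.

Lemma bernstein_variance N (t : R) : (0 < N)%N ->
  \sum_(k < N.+1) (bernstein N k).[t] * (k%:R / N%:R - t) ^+ 2 =
  t * (1 - t) / N%:R.
Proof.
move=> N0; have N0' : N%:R != 0 :> R by rewrite pnatr_eq0 -lt0n.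
transitivity (\sum_(k < N.+1) (bernstein N k).[t] *
   (N%:R ^- 2 * k%:R ^+ 2 + (- 2 * t / N%:R) * k%:R + t ^+ 2)).
  by apply: eq_bigr => k _; congr (_ * _); field.
by rewrite bernstein_moments; field.
Qed.

End bernstein.

Section tensor.
Context {R : realType} {n : nat}.

Definition tensor (s : seq (R * ('I_n -> {poly R}))) (x : 'rV[R]_n) : R :=
  \sum_(c <- s) c.1 * \prod_j (c.2 j).[x 0 j].

Lemma sum_prod_bernstein N (t : 'I_n -> R) :
  \sum_(k : {ffun 'I_n -> 'I_N.+1}) \prod_i (bernstein N (k i)).[t i] = 1.
Proof.
rewrite -(bigA_distr_bigA (fun i (k : 'I_N.+1) => (bernstein N k).[t i])).
by apply: big1 => i _; exact: sum_bernstein.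
Qed.

(** The marginal of a product distribution: once the sum is distributed over the product, every
    factor other than the one of index j sums to 1. *)
Lemma sum_prod_bernstein_coord N (t : 'I_n -> R) (j : 'I_n) (g : nat -> R) :
  \sum_(k : {ffun 'I_n -> 'I_N.+1}) (\prod_i (bernstein N (k i)).[t i]) * g (k j) =
  \sum_(k < N.+1) (bernstein N k).[t j] * g k.
Proof.
pose G i (k : 'I_N.+1) := (bernstein N k).[t i] * (if i == j then g k else 1).
transitivity (\prod_i \sum_(k < N.+1) G i k).
  rewrite bigA_distr_bigA; apply: eq_bigr => k _ /=.
  rewrite /G big_split/=; congr (_ * _).
  rewrite (bigD1 j)//= eqxx big1 ?mulr1// => i /negbTE ->.
  by [].
rewrite (bigD1 j)//= [X in _ * X]big1 ?mulr1.
  by apply: eq_bigr => k _; rewrite /G eqxx.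
move=> i /negbTE ij; rewrite -[RHS](sum_bernstein N (t i)).
by apply: eq_bigr => k _; rewrite /G ij mulr1.
Qed.

(** Bernstein's probabilistic argument on [-M, M]^n: J at a random grid point is close to J at x in
    expectation, because J is Lipschitz and each coordinate of the grid point has small variance. *)
Lemma tensor_approx (J : 'rV[R]_n -> R) (M e : R) :
  lipschitz_on_balls J -> 0 < e ->
  exists s, forall x, `|x| <= M -> `|J x - tensor s x| <= e.
Proof.
move=> lipJ e0.
(* The affine change from [-M, M] to [0, 1] divides by 2 M. *)
wlog M0 : M / 0 < M.
  move=> H; have [|s hs] := H (Num.max M 1); first by rewrite lt_max ltr01 orbT.
  by exists s => x xM; apply: hs; rewrite le_max xM.
have [L L0 hL] := lipJ M.
(* Each coordinate will cost L 2M d, hence C d in total, which is at most e; the 1 in [C + 1] covers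
   C = 0. The choice [N >= d^-2] brings the variance t (1 - t) / N below d^2. *)
pose C := L * (2 * M) * n%:R.
have C0 : 0 <= C by rewrite !mulr_ge0// ltW.
pose d := e / (C + 1).
have d0 : 0 < d by rewrite divr_gt0// ltr_wpDl.
pose N := (Num.bound (d ^- 2)).+1.
have N0 : 0 < N%:R :> R by rewrite ltr0n.
have dN : d ^- 2 <= N%:R.
  by rewrite ltW// (lt_trans (archi_boundP _))// ?invr_ge0 ?sqr_ge0// ltr_nat.
pose p (k : {ffun 'I_n -> 'I_N.+1}) : 'rV[R]_n :=
  \row_j (2 * M * ((k j)%:R / N%:R) - M).
pose q : {poly R} := (2 * M)^-1 *: 'X + 2^-1%:P.
exists [seq (J (p k), fun j => bernstein N (k j) \Po q) |
  k <- index_enum {ffun 'I_n -> 'I_N.+1}].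
move=> x xM.
pose t j := (2 * M)^-1 * x 0 j + 2^-1.
have t01 j : 0 <= t j <= 1.
  have := le_trans (mx_norm_coord x j) xM; rewrite ler_norml => /andP[x1 x2].
  have M20 : 0 < 2 * M by rewrite mulr_gt0.
  have -> : t j = (x 0 j + M) / (2 * M) by rewrite /t; field; rewrite gt_eqF.
  by rewrite ler_pdivrMr// divr_ge0 ?(ltW M20)//=; lra.
pose W (k : {ffun 'I_n -> 'I_N.+1}) := \prod_i (bernstein N (k i)).[t i].
have W0 k : 0 <= W k by apply: prodr_ge0 => i _; exact: bernstein_ge0.
have -> : tensor [seq (J (p k), fun j => bernstein N (k j) \Po q) |
    k <- index_enum {ffun 'I_n -> 'I_N.+1}] x = \sum_k J (p k) * W k.
  rewrite /tensor big_map; apply: eq_bigr => k _; congr (_ * _).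
  by apply: eq_bigr => j _ /=; rewrite horner_comp /q !hornerE.
rewrite -[J x]mulr1 -(sum_prod_bernstein N t) mulr_sumr -sumrB.
apply: (le_trans (ler_norm_sum _ _ _)).
have pM k : `|p k| <= M.
  apply: mx_norm_le => [|j]; first exact: ltW.
  rewrite mxE ler_norml.
  have k1 : 0 <= ((k j)%:R / N%:R : R) <= 1.
    apply/andP; split; first exact: divr_ge0.
    by rewrite ler_pdivrMr// mul1r ler_nat -ltnS.
  move/andP: k1; set r := _ / _ => -[r0 r1].
  by apply/andP; split; nra.
(* The inequality |y| <= (d + y^2 / d) / 2 replaces the first absolute moment by the variance. *)
have step k : `|J x * W k - J (p k) * W k| <=
   \sum_j L * (2 * M) * (W k * (2^-1 * (d + ((k j)%:R / N%:R - t j) ^+ 2 / d))).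
  rewrite -mulrBl normrM (ger0_norm (W0 k)).
  have h1 := hL _ _ xM (pM k).
  apply: (le_trans (ler_wpM2r (W0 k) h1)).
  apply: (le_trans (ler_wpM2r (W0 k) (ler_wpM2l L0 (mx_norm_le_sum _)))).
  rewrite mulr_sumr mulr_suml; apply: ler_sum => j _.
  have -> : (x - p k) 0 j = (2 * M) * (t j - (k j)%:R / N%:R).
    by rewrite !mxE /t; field; rewrite !gt_eqF.
  rewrite normrM gtr0_norm ?mulr_gt0// distrC.
  set y := _ - t j.
  have -> : L * (2 * M * `|y|) * W k = L * (2 * M) * (W k * `|y|) by ring.
  rewrite ler_wpM2l ?mulr_ge0 ?(ltW M0)// ler_wpM2l//.
  rewrite ler_pdivlMl// -lerBlDl ler_pdivlMr// -subr_ge0 -[y ^+ 2]real_normK ?num_real//.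
  by have := sqr_ge0 (`|y| - d); nra.
apply: (le_trans (ler_sum _ (fun k _ => step k))).
rewrite exchange_big /=.
have tail j : \sum_k L * (2 * M) * (W k * (2^-1 * (d + ((k j)%:R / N%:R - t j) ^+ 2 / d)))
    <= L * (2 * M) * d.
  rewrite -mulr_sumr ler_wpM2l ?mulr_ge0 ?(ltW M0)//.
  rewrite (sum_prod_bernstein_coord N t j
    (fun k => 2^-1 * (d + (k%:R / N%:R - t j) ^+ 2 / d))).
  have -> : \sum_(k < N.+1) (bernstein N k).[t j] *
      (2^-1 * (d + (k%:R / N%:R - t j) ^+ 2 / d)) =
      2^-1 * (d * 1 + (t j * (1 - t j) / N%:R) / d).
    rewrite -[X in d * X](sum_bernstein N (t j)) -bernstein_variance//.
    rewrite mulr_sumr mulr_suml -big_split/= mulr_sumr.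
    by apply: eq_bigr => k _; ring.
  rewrite ler_pdivrMl// mulr1 mulr_natl mulr2n lerD2l.
  have /andP[t0 t1] := t01 j.
  rewrite ler_pdivrMr// ler_pdivrMr// (le_trans (_ : _ <= 1))//; first by nra.
  rewrite (le_trans (_ : 1 <= d ^+ 2 * d ^- 2))//.
    by rewrite divff// expf_neq0// gt_eqF.
  by rewrite -expr2 ler_wpM2l// sqr_ge0.
apply: (le_trans (ler_sum _ (fun j _ => tail j))).
rewrite sumr_const card_ord -[leLHS]mulr_natr.
have -> : L * (2 * M) * d * n%:R = C * e / (C + 1) by rewrite /C /d; ring.
by rewrite ler_pdivrMr ?ltr_wpDl// mulrC ler_pM2l// lerDl.
Qed.
End tensor.

(** * Means of polynomials in sin t and smoothing in one variable *)

Section one_variable_integrals.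
Context {R : realType}.
Local Notation mu := (@lebesgue_measure R).
Implicit Types (f F : R -> R) (p q : {poly R}).

Lemma continuous_integrable_itv f (a b : R) : continuous f ->
  mu.-integrable `[a, b] (EFin \o f).
Proof.
move=> cf; apply: continuous_compact_integrable; first exact: segment_compact.
exact: continuous_subspaceT.
Qed.

Lemma continuous_RFTC2 f F (a b : R) : a < b -> continuous f ->
  (forall x : R, is_derive x 1 F (f x)) -> \int[mu]_(x in `[a, b]) f x = F b - F a.
Proof.
move=> ab cf dF; rewrite /Rintegral.
have cF (x : R) : {for x, continuous F}.
  by apply: differentiable_continuous; apply/derivable1_diffP; have [] := dF x.
rewrite (@continuous_FTC2 _ f F)//.
- exact: continuous_subspaceT.
- split.
  + by move=> x _; exact: (@ex_derive _ _ _ _ _ _ _ (dF x)).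
  + by apply: cvg_at_right_filter; exact: cF.
  + by apply: cvg_at_left_filter; exact: cF.
- by move=> x _; rewrite derive1E (@derive_val _ _ _ _ _ _ _ (dF x)).
Qed.

Lemma continuous_horner_comp p f : continuous f -> continuous (fun t => p.[f t]).
Proof. by move=> cf x; apply: continuous_comp; [exact: cf|exact: continuous_horner]. Qed.

Lemma is_derive_horner_comp p f (x df : R) :
  is_derive x 1 f df -> is_derive x 1 (fun t => p.[f t]) (p^`().[f x] * df).
Proof.
move=> dfx; have dp := is_derive_poly p (f x).
exact: (is_derive1_comp dp dfx).
Qed.

(** By the symmetry t -> pi - t this half period has the same mean as a full one, and sin is
    increasing on it, so u = sin t is a legitimate substitution. *)
Definition sin_mean p : R :=
  pi^-1 * \int[mu]_(t in `[- (pi / 2), pi / 2]) p.[sin t].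

Let cont_sin p : continuous (fun t : R => p.[sin t]).
Proof. by apply: continuous_horner_comp; exact: continuous_sin. Qed.

Lemma sin_meanD p q : sin_mean (p + q) = sin_mean p + sin_mean q.
Proof.
rewrite /sin_mean -mulrDr -RintegralD//; [|exact: continuous_integrable_itv..].
by under eq_Rintegral do rewrite hornerD.
Qed.

Lemma sin_meanZ k p : sin_mean (k *: p) = k * sin_mean p.
Proof.
rewrite /sin_mean mulrCA; congr (_ * _).
rewrite -RintegralZl//; last exact: continuous_integrable_itv.
by under eq_Rintegral do rewrite hornerZ.
Qed.

Let pi2_lt : - (pi / 2) < pi / 2 :> R.
Proof. by have := pi_gt0 R; lra. Qed.

Lemma sin_mean1 : sin_mean 1 = 1.
Proof.
have d1 (t : R) : is_derive t 1 id (1 : {poly R}).[sin t].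
  by apply: is_derive_eq; rewrite hornerC.
rewrite /sin_mean (continuous_RFTC2 pi2_lt (@cont_sin 1) d1).
by have := pi_gt0 R; move=> ?; field; lra.
Qed.

(* This is an integration by parts, with antiderivative p (sin t) cos t. *)
Lemma sin_meanMX p : sin_mean ('X * p) = sin_mean ((1 - 'X^2) * p^`()).
Proof.
apply/esym/subr0_eq.
rewrite -[- sin_mean _]mulN1r -sin_meanZ -sin_meanD /sin_mean.
set q := _ + _.
have dq (t : R) : is_derive t 1 (fun t => p.[sin t] * cos t) q.[sin t].
  have dsin := is_derive_horner_comp p (is_derive_sin t).
  apply: is_derive_eq; rewrite /q !hornerE /=.
  rewrite -[_ *: _]/(_ * _) -[X in _ + X]/(_ * _).
  have := sin2cos2 t => ->; ring.
rewrite (continuous_RFTC2 pi2_lt (@cont_sin q) dq).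
by rewrite cosN cos_pihalf !mulr0 subrr mulr0.
Qed.

Lemma continuous_sqrt_weight : continuous (fun u : R => Num.sqrt (1 - u ^+ 2)).
Proof.
move=> x; apply: continuous_comp; last exact: sqrt_continuous.
by apply: cvgB; [exact: cvg_cst|exact: exprn_continuous].
Qed.

(* Substitution u = sin t in the weight of kappa. *)
Lemma integral_sqrt_weight p :
  \int[mu]_(u in `[-1, 1]) (p.[u] * Num.sqrt (1 - u ^+ 2)) =
  pi * sin_mean ((1 - 'X^2) * p).
Proof.
have pi_neq0 : pi != 0 :> R by rewrite gt_eqF// pi_gt0.
rewrite /sin_mean mulrA divff// mul1r /Rintegral; congr fine.
have dsin : derive1 (@sin R) = cos.
  by apply/funext => x; rewrite derive1E derive_val.
have [sNpi spi] : sin (- (pi / 2)) = -1 :> R /\ sin (pi / 2) = 1 :> R.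
  by rewrite sinN sin_pihalf.
have := @integration_by_substitution_increasing R sin
  (fun u => p.[u] * Num.sqrt (1 - u ^+ 2)) _ _ (ltW pi2_lt).
rewrite sNpi spi dsin => ->.
- apply: eq_integral => t; rewrite inE/= in_itv/= => tpi.
  congr EFin.
  transitivity (p.[sin t] * Num.sqrt (1 - sin t ^+ 2) * cos t) => //.
  rewrite -[1 - sin t ^+ 2]cos2sin2 sqrtr_sqr ger0_norm ?cos_ge0_pihalf//.
  by rewrite !hornerE -[1 - sin t ^+ 2]cos2sin2; ring.
- move=> x y xpi ypi; by rewrite ltr_sin.
- by move=> x _; exact: continuous_cos.
- by apply: cvgP; apply: cvg_at_right_filter; exact: continuous_cos.
- by apply: cvgP; apply: cvg_at_left_filter; exact: continuous_cos.
- split.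
  + by move=> x _; exact: derivable_sin.
  + by apply: cvg_at_right_filter; exact: continuous_sin.
  + by apply: cvg_at_left_filter; exact: continuous_sin.
- apply: continuous_subspaceT => x; apply: cvgM; first exact: continuous_horner.
  exact: continuous_sqrt_weight.
Qed.

Lemma sin_mean_sum I (r : seq I) (P : pred I) (F : I -> {poly R}) :
  sin_mean (\sum_(i <- r | P i) F i) = \sum_(i <- r | P i) sin_mean (F i).
Proof.
apply: (big_morph sin_mean sin_meanD).
by rewrite -[X in sin_mean X](scale0r 0) sin_meanZ mul0r.
Qed.

Lemma eq_sin_mean p q : (forall u, p.[u] = q.[u]) -> sin_mean p = sin_mean q.
Proof. by move=> pq; rewrite /sin_mean; under eq_Rintegral do rewrite pq. Qed.

(** The mean for the semicircle law on [-1, 1], since 1 - X^2 evaluated at sin t is cos^2 t. *)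
Definition semicircle_mean p := 2 * sin_mean ((1 - 'X^2) * p).

(* Termwise mean of the Taylor expansion of p (z + a u) in u, so that the
   smoothed polynomial is visibly a polynomial in z. *)
Definition smooth (a : R) p : {poly R} :=
  \sum_(i < size p) (a ^+ i * semicircle_mean 'X^i) *: p^`N(i).

Lemma smooth_widen a p N : (size p <= N)%N ->
  smooth a p = \sum_(i < N) (a ^+ i * semicircle_mean 'X^i) *: p^`N(i).
Proof.
move=> pN; rewrite /smooth (big_ord_widen N (fun i => (a ^+ i * semicircle_mean 'X^i) *: p^`N(i)))//.
rewrite [RHS](bigID (fun i : 'I_N => (i < size p)%N))/= [X in _ + X]big1 ?addr0// => i.
by rewrite -leqNgt => ?; rewrite nderivn_poly0// scaler0.
Qed.

Lemma smoothE a p z :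
  (smooth a p).[z] = semicircle_mean (p \Po (z%:P + a *: 'X)).
Proof.
rewrite /semicircle_mean (@eq_sin_mean _
  (\sum_(i < size p) (p^`N(i).[z] * a ^+ i) *: ((1 - 'X^2) * 'X^i))).
  rewrite sin_mean_sum mulr_sumr horner_sum; apply: eq_bigr => i _.
  by rewrite sin_meanZ hornerZ /semicircle_mean; ring.
move=> u; rewrite hornerM horner_comp !hornerE nderiv_taylor; last exact: mulrC.
rewrite mulr_sumr horner_sum; apply: eq_bigr => i _.
by rewrite !hornerE exprMn /=; ring.
Qed.

Lemma deriv_nderivn p i : (p^`N(i))^`() = (p^`())^`N(i).
Proof.
have fi : (i`!)%:R != 0 :> R by rewrite pnatr_eq0 -lt0n fact_gt0.
apply: (scalerI fi).
by rewrite -derivZ !scaler_nat -!nderivn_def -derivnS derivSn.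
Qed.

Lemma deriv_smooth a p : (smooth a p)^`() = smooth a p^`().
Proof.
rewrite (@smooth_widen a p^`() (size p)); last first.
  by have [->|p0] := eqVneq p 0; [rewrite linear0|rewrite ltnW// lt_size_deriv].
rewrite /smooth raddf_sum; apply: eq_bigr => i _ /=.
by rewrite derivZ deriv_nderivn.
Qed.

Lemma integral_smooth a p z :
  \int[mu]_(u in `[-1, 1]) (p.[z + a * u] * (2 / pi * Num.sqrt (1 - u ^+ 2))) =
  (smooth a p).[z].
Proof.
have pi_neq0 : pi != 0 :> R by rewrite gt_eqF// pi_gt0.
rewrite smoothE /semicircle_mean.
rewrite -[sin_mean _](mulKf pi_neq0) -integral_sqrt_weight mulrA.
rewrite -RintegralZl//; last first.
  apply: continuous_integrable_itv => x.
  by apply: cvgM; [exact: continuous_horner|exact: continuous_sqrt_weight].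
apply: eq_Rintegral => u _; rewrite horner_comp.
by rewrite (_ : (_ + _).[u] = z + a * u) ?hornerE//=; ring.
Qed.

(** Integration by parts removes the factor X, and the chain rule contributes the a that later
    cancels the 1 / a of F. *)
Lemma sin_mean_smooth_deriv a p z :
  2 * sin_mean ('X * (p \Po (z%:P + a *: 'X))) = a * (smooth a p^`()).[z].
Proof.
rewrite sin_meanMX deriv_comp smoothE /semicircle_mean.
rewrite [RHS]mulrCA -(sin_meanZ a); congr (_ * sin_mean _).
by rewrite derivD derivC derivZ derivX add0r -!scalerAr mulr1.
Qed.

End one_variable_integrals.

(** * Time means over long windows *)

Section time_mean.
Context {R : realType} (t0 : R).
Local Notation mu := (@lebesgue_measure R).
Implicit Types (f g : R -> R).

Definition time_mean f (T : R) : R :=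
  T^-1 * \int[mu]_(t in `[t0, t0 + T]) f t.

(** Continuity is included so that integrability on every window, on which linearity rests, is
    carried along. *)
Definition has_mean f (c : R) : Prop :=
  continuous f /\ time_mean f T @[T --> +oo] --> c.

Lemma time_meanD f g T : continuous f -> continuous g ->
  time_mean (fun t => f t + g t) T = time_mean f T + time_mean g T.
Proof.
move=> cf cg; rewrite /time_mean RintegralD//; first by rewrite mulrDr.
all: exact: continuous_integrable_itv.
Qed.

Lemma time_meanZ k f T : continuous f ->
  time_mean (fun t => k * f t) T = k * time_mean f T.
Proof.
move=> cf; rewrite /time_mean RintegralZl//; first by rewrite mulrCA.
exact: continuous_integrable_itv.
Qed.

Lemma time_mean_cst k T : 0 < T -> time_mean (fun=> k) T = k.
Proof.
move=> T0; rewrite /time_mean Rintegral_cst//= lebesgue_measure_itv/= lte_fin.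
by rewrite ltrDl T0 -EFinB/= addrAC subrr add0r mulrCA mulVf ?mulr1// gt_eqF.
Qed.

Lemma le_time_mean f g T : 0 < T -> continuous f -> continuous g ->
  (forall t, f t <= g t) -> time_mean f T <= time_mean g T.
Proof.
move=> T0 cf cg fg; rewrite /time_mean ler_wpM2l ?invr_ge0 ?(ltW T0)//.
by apply: le_Rintegral => //; exact: continuous_integrable_itv.
Qed.

Lemma time_mean_bound f k T : 0 < T -> continuous f ->
  (forall t, `|f t| <= k) -> `|time_mean f T| <= k.
Proof.
move=> T0 cf fk; rewrite ler_norml -{1}(time_mean_cst (- k) T0).
rewrite -[X in _ && (_ <= X)](time_mean_cst k T0).
apply/andP; split; apply: le_time_mean => //; try exact: cst_continuous.
all: by move=> t; have := fk t; rewrite ler_norml => /andP[].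
Qed.

Lemma has_meanD f g c d : has_mean f c -> has_mean g d ->
  has_mean (fun t => f t + g t) (c + d).
Proof.
move=> [cf fc] [cg gd]; split.
  by move=> x; apply: cvgD; [exact: cf|exact: cg].
rewrite (_ : (fun T => _) = (fun T => time_mean f T + time_mean g T)).
  exact: cvgD.
by apply/funext => T; exact: time_meanD.
Qed.

Lemma has_meanZ k f c : has_mean f c -> has_mean (fun t => k * f t) (k * c).
Proof.
move=> [cf fc]; split.
  by move=> x; apply: cvgM; [exact: cvg_cst|exact: cf].
rewrite (_ : (fun T => _) = (fun T => k * time_mean f T)).
  by apply: cvgM => //; exact: cvg_cst.
by apply/funext => T; exact: time_meanZ.
Qed.

Lemma has_mean_cst k : has_mean (fun=> k) k.
Proof.
split; first exact: cst_continuous.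
apply: cvg_near_cst; near=> T; apply: time_mean_cst.
by near: T; apply: nbhs_pinfty_gt; exact: num_real.
Unshelve. all: by end_near. Qed.

Lemma eq_has_mean f g c : f =1 g -> has_mean f c -> has_mean g c.
Proof. by move=> /funext ->. Qed.

Lemma has_mean_sum (I : Type) (r : seq I) (F : I -> R -> R) (c : I -> R) :
  (forall i, has_mean (F i) (c i)) ->
  has_mean (fun t => \sum_(i <- r) F i t) (\sum_(i <- r) c i).
Proof.
move=> Fc; elim: r => [|i r IH].
  rewrite big_nil; apply: eq_has_mean (has_mean_cst 0).
  by move=> t; rewrite big_nil.
rewrite big_cons; apply: eq_has_mean (has_meanD (Fc i) IH).
by move=> t; rewrite big_cons.
Qed.

Lemma continuous_cos_affine (l d : R) : continuous (fun t : R => cos (l * t + d)).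
Proof.
move=> x; apply: continuous_comp; last exact: continuous_cos.
by apply: cvgD; [apply: cvgM; [exact: cvg_cst|exact: cvg_id]|exact: cvg_cst].
Qed.

(** For l nonzero the antiderivative is bounded by 1 / |l|, so every window integral is at most 2 /
    |l|, wherever the window starts. *)
Lemma has_mean_cos (l d : R) :
  has_mean (fun t => cos (l * t + d)) (if l == 0 then cos d else 0).
Proof.
have [->|l0] := eqVneq l 0.
  by apply: eq_has_mean (has_mean_cst (cos d)) => t; rewrite mul0r add0r.
split; first exact: continuous_cos_affine.
have Tint T : 0 < T -> `|time_mean (fun t => cos (l * t + d)) T| <= 2 / `|l| * T^-1.
  move=> T0; rewrite /time_mean.
  have dF (t : R) : is_derive t 1 (fun t => l^-1 * sin (l * t + d)) (cos (l * t + d)).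
    have dl : is_derive t 1 (fun t : R => l * t + d) l.
      by apply: is_derive_eq; rewrite /GRing.scale/= mulr1 addr0.
    have ds := @is_derive1_comp _ sin (fun t => l * t + d) t _ _
      (is_derive_sin (l * t + d)) dl.
    apply: (is_derive_eq (is_deriveZ l^-1 ds)).
    by rewrite /GRing.scale/=; field.
  have tT : t0 < t0 + T by rewrite ltrDl.
  rewrite (continuous_RFTC2 tT (@continuous_cos_affine l d) dF).
  rewrite normrM mulrC [`|T^-1|]ger0_norm ?invr_ge0 ?(ltW T0)// ler_wpM2r ?invr_ge0 ?(ltW T0)//.
  rewrite -mulrBr normrM normfV mulrC ler_wpM2r ?invr_ge0//.
  apply: (le_trans (ler_normB _ _)).
  by rewrite (_ : 2 = 1 + 1)// lerD// sin_max.
have V0 : 2 / `|l| * T^-1 @[T --> +oo] --> (0 : R).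
  rewrite -[X in _ --> X](mulr0 (2 / `|l|)); apply: cvgM; first exact: cvg_cst.
  apply/gtr0_cvgV0; last exact: cvg_id.
  by apply: nbhs_pinfty_gt; exact: num_real.
apply/cvgr0Pnorm_le => e e0.
near=> T; apply: le_trans (Tint T _) _.
  by near: T; apply: nbhs_pinfty_gt; exact: num_real.
apply: le_trans (ler_norm _) _.
by near: T; move/cvgr0Pnorm_le : V0; apply.
Unshelve. all: by end_near. Qed.

End time_mean.

(** * Trigonometric sums with integer frequencies *)

Section trigonometric_sums.
Context {R : realType}.
Implicit Types (f g : R -> R) (s : seq (R * int * R)).

(* The triple (b, k, d) stands for b cos (k t + d). *)
Definition trig_sum s (t : R) : R :=
  \sum_(r <- s) r.1.1 * cos (r.1.2%:~R * t + r.2).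

Definition trig_mean s : R :=
  \sum_(r <- s) (if r.1.2 == 0 then r.1.1 * cos r.2 else 0).

(** The mean is read off one representation of f, as the part of frequency zero. *)
Definition is_trig f c := exists2 s, f =1 trig_sum s & c = trig_mean s.

Lemma eq_is_trig f g c : f =1 g -> is_trig f c -> is_trig g c.
Proof. by move=> /funext ->. Qed.

Lemma is_trig_cst k : is_trig (fun=> k) k.
Proof.
exists [:: (k, 0, 0)] => [t|]; rewrite /trig_sum /trig_mean big_seq1/=.
  by rewrite mul0r addr0 cos0 mulr1.
by rewrite cos0 mulr1.
Qed.

Lemma is_trig_sin : is_trig sin 0.
Proof.
exists [:: (1, 1, - (pi / 2))] => [t|]; rewrite /trig_sum /trig_mean big_seq1//=.
by rewrite !mul1r cosBpihalf.
Qed.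

Lemma is_trig_cos : is_trig cos 0.
Proof.
exists [:: (1, 1, 0)] => [t|]; rewrite /trig_sum /trig_mean big_seq1//=.
by rewrite !mul1r addr0.
Qed.

Lemma is_trigD f g c d : is_trig f c -> is_trig g d ->
  is_trig (fun t => f t + g t) (c + d).
Proof.
move=> [s fs ->] [s' gs ->]; exists (s ++ s').
  by move=> t; rewrite fs gs /trig_sum big_cat.
by rewrite /trig_mean big_cat.
Qed.

Lemma is_trigZ k f c : is_trig f c -> is_trig (fun t => k * f t) (k * c).
Proof.
move=> [s fs ->]; exists [seq (k * r.1.1, r.1.2, r.2) | r <- s].
  move=> t; rewrite fs /trig_sum big_map mulr_sumr; apply: eq_bigr => r _ /=.
  by rewrite mulrA.
rewrite /trig_mean big_map mulr_sumr; apply: eq_bigr => r _ /=.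
by case: ifP => _; rewrite ?mulr0// mulrA.
Qed.

Lemma is_trig_sum (I : Type) (r : seq I) (F : I -> R -> R) (c : I -> R) :
  (forall i, is_trig (F i) (c i)) ->
  is_trig (fun t => \sum_(i <- r) F i t) (\sum_(i <- r) c i).
Proof.
move=> Fc; elim: r => [|i r IH].
  rewrite big_nil; apply: eq_is_trig (is_trig_cst 0).
  by move=> t; rewrite big_nil.
rewrite big_cons; apply: eq_is_trig (is_trigD (Fc i) IH).
by move=> t; rewrite big_cons.
Qed.

Lemma cosMcos (x y : R) : cos x * cos y = 2^-1 * (cos (x + y) + cos (x - y)).
Proof. by rewrite cosD cosB; field. Qed.

Lemma is_trig_cos_affine b (k : int) d :
  exists c, is_trig (fun t => b * cos (k%:~R * t + d)) c.
Proof.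
eexists; exists [:: (b, k, d)] => [t|]; last by [].
by rewrite /trig_sum big_seq1.
Qed.

(** The product-to-sum formula keeps frequencies integral. The mean is left unspecified because the
    lemma serves for sin^(m+1) cos, of which only the derivative is then considered. *)
Lemma is_trigM f g c d : is_trig f c -> is_trig g d ->
  exists e, is_trig (fun t => f t * g t) e.
Proof.
move=> [s fs _] [s' gs _].
have prod_cos b (k : int) (d1 : R) b' (k' : int) d' :
    {e : R | is_trig (fun t => (b * cos (k%:~R * t + d1)) * (b' * cos (k'%:~R * t + d'))) e}.
  apply: cid.
  have [e1 h1] := is_trig_cos_affine (2^-1 * (b * b')) (k + k') (d1 + d').
  have [e2 h2] := is_trig_cos_affine (2^-1 * (b * b')) (k - k') (d1 - d').
  exists (e1 + e2); apply: eq_is_trig (is_trigD h1 h2) => t.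
  rewrite -mulrDr mulrACA cosMcos intrD intrB.
  rewrite (_ : (_ + _) * t + (d1 + d') = (k%:~R * t + d1) + (k'%:~R * t + d')); last by ring.
  rewrite (_ : (_ - _) * t + (d1 - d') = (k%:~R * t + d1) - (k'%:~R * t + d')); last by ring.
  by ring.
pose e r r' := sval (prod_cos r.1.1 r.1.2 r.2 r'.1.1 r'.1.2 r'.2).
exists (\sum_(r <- s) \sum_(r' <- s') e r r').
apply: (@eq_is_trig (fun t => \sum_(r <- s) \sum_(r' <- s')
   (r.1.1 * cos (r.1.2%:~R * t + r.2)) * (r'.1.1 * cos (r'.1.2%:~R * t + r'.2)))).
  move=> t; rewrite fs gs /trig_sum mulr_suml; apply: eq_bigr => r _.
  by rewrite mulr_sumr.
apply: is_trig_sum => r; apply: is_trig_sum => r'.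
exact: (svalP (prod_cos _ _ _ _ _ _)).
Qed.

(** Differentiation multiplies each coefficient by its frequency and so kills the term of frequency
    zero; the shift by pi / 2 writes -sin as a cosine again. *)
Lemma is_trig_deriv f g c : is_trig f c ->
  (forall t : R, is_derive t 1 f (g t)) -> is_trig g 0.
Proof.
move=> [s fs _] df.
exists [seq (r.1.1 * r.1.2%:~R, r.1.2, r.2 + pi / 2) | r <- s]; last first.
  rewrite /trig_mean big_map big1// => r _ /=.
  by case: eqP => // ->; rewrite mulr0 mul0r.
move=> t; rewrite -(@derive_val _ _ _ _ _ _ _ (df t)).
rewrite (funext fs) /trig_sum big_map.
suff h : is_derive t 1 (fun t : R => \sum_(r <- s) r.1.1 * cos (r.1.2%:~R * t + r.2))
    (\sum_(r <- s) r.1.1 * r.1.2%:~R * cos (r.1.2%:~R * t + (r.2 + pi / 2))).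
  by rewrite derive_val.
elim: s {fs} => [|r s IH].
  rewrite big_nil; apply: is_derive_eq; last exact: erefl.
  rewrite (_ : (fun _ => _) = cst 0); first exact: is_derive_cst.
  by apply/funext => u; rewrite big_nil.
rewrite big_cons (_ : (fun _ => _) =
  (fun t : R => r.1.1 * cos (r.1.2%:~R * t + r.2)) +
  (fun t : R => \sum_(r <- s) r.1.1 * cos (r.1.2%:~R * t + r.2))); last first.
  by apply/funext => u; rewrite big_cons.
apply: is_deriveD.
have dl : is_derive t 1 (fun t : R => r.1.2%:~R * t + r.2) r.1.2%:~R.
  by apply: is_derive_eq; rewrite /GRing.scale/= mulr1 addr0.
have ds := @is_derive1_comp _ cos (fun t => r.1.2%:~R * t + r.2) t _ _
  (is_derive_cos _) dl.
apply: (is_derive_eq (is_deriveZ r.1.1 ds)).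
by rewrite addrA cosDpihalf /GRing.scale/=; ring.
Qed.

(** The derivative of sin^(m+1) cos is (m+1) sin^m - (m+2) sin^(m+2) and has mean 0. This is the
    recurrence that integration by parts gives for [sin_mean]; it steps by two, hence the two
    consecutive powers. *)
Lemma is_trig_sinX m : is_trig (fun t => sin t ^+ m) (sin_mean 'X^m) /\
  is_trig (fun t => sin t ^+ m.+1) (sin_mean 'X^(m.+1)).
Proof.
elim: m => [|m [IH1 IH2]].
  split; first by rewrite sin_mean1; exact: is_trig_cst.
  rewrite expr1 -['X]mulr1 sin_meanMX derivC mulr0.
  rewrite -(scale0r 0) sin_meanZ mul0r.
  exact: is_trig_sin.
split=> //.
have [c hg] := is_trigM IH2 is_trig_cos.
have hg' : is_trig (fun t => m.+1%:R * sin t ^+ m - m.+2%:R * sin t ^+ m.+2) 0.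
  apply: (is_trig_deriv hg) => t.
  have dX : is_derive t 1 (fun t : R => sin t ^+ m.+1) (m.+1%:R * sin t ^+ m * cos t).
    have := is_derive_horner_comp 'X^(m.+1) (is_derive_sin t).
    rewrite derivXn hornerMn hornerXn mulr_natl.
    by rewrite (_ : (fun _ => _) = (fun t => sin t ^+ m.+1))//; apply/funext => u; rewrite hornerXn.
  apply: (is_derive_eq (is_deriveM dX (is_derive_cos t))).
  rewrite /GRing.scale/= !exprS -[m.+2%:R]natr1.
  have -> : cos t * (m.+1%:R * sin t ^+ m * cos t) = m.+1%:R * sin t ^+ m * cos t ^+ 2 by ring.
  by rewrite cos2sin2; ring.
(* The zero summand is kept so that the value has the shape of the combination of sin^m and [hg']
   that equals sin^(m+2). *)
have E : sin_mean 'X^(m.+2) = (m.+1%:R / m.+2%:R : R) * sin_mean 'X^m + (- m.+2%:R^-1) * 0.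
  rewrite mulr0 addr0.
  have := sin_meanMX ('X^(m.+1) : {poly R}).
  rewrite -exprS derivXn.
  rewrite (_ : (1 - 'X^2) * ('X^(m.+1.-1) *+ m.+1) =
    (m.+1%:R : R) *: 'X^m + (- m.+1%:R : R) *: 'X^(m.+2) :> {poly R}); last first.
    by rewrite /= -scaler_nat -scalerAr scaleNr -scalerBr mulrBl mul1r -exprD.
  rewrite sin_meanD !sin_meanZ => H.
  have H' : m.+2%:R * sin_mean 'X^(m.+2) = m.+1%:R * sin_mean 'X^m :> R.
    by rewrite -[m.+2%:R]natr1 mulrDl {2}H; ring.
  by rewrite mulrAC -H' mulrC mulKf// pnatr_eq0.
rewrite E; apply: eq_is_trig (is_trigD (is_trigZ _ IH1) (is_trigZ _ hg')) => t.
have : m.+2%:R != 0 :> R by rewrite pnatr_eq0.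
by move: m.+2%:R m.+1%:R => x y x0; field.
Qed.

Lemma is_trig_poly_sin (p : {poly R}) :
  is_trig (fun t => p.[sin t]) (sin_mean p).
Proof.
rewrite -{2}[p]coefK poly_def sin_mean_sum.
apply: (@eq_is_trig (fun t => \sum_(i < size p) p`_i * sin t ^+ i)).
  by move=> t; rewrite horner_coef.
under eq_bigr do rewrite sin_meanZ.
by apply: is_trig_sum => i; apply: is_trigZ; have [] := is_trig_sinX i.
Qed.

End trigonometric_sums.

(** * Rational independence and factorization of time means *)

Section equidistribution.
Context {R : realType} {n : nat} (w : 'rV[R]_n) (t0 : R).
Hypothesis w_indep : rationally_independent w.

Let freq (l : {ffun 'I_n -> int}) : R := \sum_i (l i)%:~R * w 0 i.

Let freq_eq0 l : (freq l == 0) = (l == 0).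
Proof.
apply/idP/eqP => [|->]; last by rewrite /freq big1// => i _; rewrite ffunE mul0r.
apply: contraTeq => l0.
have : (\row_i ((l i)%:~R : rat)) != 0.
  apply: contraNneq l0 => /rowP h; apply/eqP/ffunP => i.
  by have := h i; rewrite !mxE ffunE => /eqP; rewrite intr_eq0 => /eqP.
move=> /w_indep; rewrite /freq.
by under eq_bigr do rewrite mxE ratr_int.
Qed.

Let single (k : int) (j : 'I_n) : {ffun 'I_n -> int} :=
  [ffun i => if i == j then k else 0].

Let freqD (l l' : {ffun 'I_n -> int}) : freq (l + l') = freq l + freq l'.
Proof. by rewrite /freq -big_split; apply: eq_bigr => i _; rewrite ffunE intrD mulrDl. Qed.

Let freqB (l l' : {ffun 'I_n -> int}) : freq (l - l') = freq l - freq l'.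
Proof. by rewrite /freq -sumrB; apply: eq_bigr => i _; rewrite !ffunE intrB mulrBl. Qed.

Let freq_single k j : freq (single k j) = k%:~R * w 0 j.
Proof.
rewrite /freq (bigD1 j)//= ffunE eqxx big1 ?addr0// => i /negbTE ij.
by rewrite ffunE ij mul0r.
Qed.

(* In the induction l vanishes on the remaining coordinates, so the frequency
   produced by a factor of index j is zero only if l and the frequency of that
   factor are both zero. *)
Let has_mean_prod_trig_cos (js : seq 'I_n) (s : 'I_n -> seq (R * int * R))
    (l : {ffun 'I_n -> int}) (d : R) :
  uniq js -> (forall j, j \in js -> l j = 0) ->
  has_mean t0 (fun t => (\prod_(j <- js) trig_sum (s j) (w 0 j * t)) *
                        cos (freq l * t + d))
    ((\prod_(j <- js) trig_mean (s j)) * (if l == 0 then cos d else 0)).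
Proof.
elim: js l d => [|j js IH] l d /=.
  move=> _ _; rewrite big_nil mul1r -freq_eq0.
  apply: eq_has_mean (has_mean_cos _ _ _) => t.
  by rewrite big_nil mul1r.
move=> /andP[jjs ujs] l0.
pose m (e : R) (r : R * int * R) l' d' :=
  2^-1 * r.1.1 * ((\prod_(j <- js) trig_mean (s j)) * (if l' == 0 then cos d' else 0)).
have lr (r : R * int * R) i : i \in js -> (l + single r.1.2 j) i = 0 /\
    (l - single r.1.2 j) i = 0.
  move=> ijs; rewrite !ffunE l0 ?inE ?ijs ?orbT//.
  by case: eqP => [ij|]; [rewrite -ij ijs in jjs|split; rewrite ?subrr ?addr0].
have main := @has_mean_sum _ t0 _ (s j)
  (fun r t => 2^-1 * r.1.1 * ((\prod_(j <- js) trig_sum (s j) (w 0 j * t)) *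
                        cos (freq (l + single r.1.2 j) * t + (d + r.2))) +
      2^-1 * r.1.1 * ((\prod_(j <- js) trig_sum (s j) (w 0 j * t)) *
                        cos (freq (l - single r.1.2 j) * t + (d - r.2))))
  _ (fun r => has_meanD
      (has_meanZ (2^-1 * r.1.1) (IH (l + single r.1.2 j) (d + r.2) ujs (fun i ijs => (lr r i ijs).1)))
      (has_meanZ (2^-1 * r.1.1) (IH (l - single r.1.2 j) (d - r.2) ujs (fun i ijs => (lr r i ijs).2)))).
have lj : l j = 0 by rewrite l0// inE eqxx.
have E : \prod_(j0 <- (j :: js)) trig_mean (s j0) * (if l == 0 then cos d else 0) =
   \sum_(r <- s j) (2^-1 * r.1.1 * ((\prod_(j <- js) trig_mean (s j)) *
       (if l + single r.1.2 j == 0 then cos (d + r.2) else 0)) +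
      2^-1 * r.1.1 * ((\prod_(j <- js) trig_mean (s j)) *
       (if l - single r.1.2 j == 0 then cos (d - r.2) else 0))).
  rewrite big_cons /trig_mean -mulrA mulr_suml; apply: eq_bigr => r _.
  have single0 : single 0 j = 0.
    by apply/ffunP => i; rewrite !ffunE if_same.
  (* At frequency zero the two halves recombine through cos (d + r) + cos (d - r) = 2 cos d cos r;
     otherwise coordinate j of both shifted frequency vectors is nonzero and both halves vanish. *)
  have [k0|k0] := eqVneq r.1.2 0.
    rewrite k0 single0 subr0 addr0; case: ifP => _; last by ring.
    by rewrite cosD cosB; field.
  have -> : (l + single r.1.2 j == 0) = false.
    apply: contraNF k0 => /eqP/ffunP/(_ j).
    by rewrite !ffunE eqxx lj add0r => /eqP.
  have -> : (l - single r.1.2 j == 0) = false.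
    apply: contraNF k0 => /eqP/ffunP/(_ j).
    by rewrite !ffunE eqxx lj add0r => /eqP; rewrite oppr_eq0.
  by ring.
rewrite E; apply: eq_has_mean main => t.
rewrite big_cons /trig_sum -mulrA mulr_suml; apply: eq_bigr => r _.
rewrite freqD freqB freq_single.
set P := \prod_(_ <- js) _.
rewrite (_ : (freq l + _) * t + (d + r.2) = (freq l * t + d) + (r.1.2%:~R * (w 0 j * t) + r.2)); last by ring.
rewrite (_ : (freq l - _) * t + (d - r.2) = (freq l * t + d) - (r.1.2%:~R * (w 0 j * t) + r.2)); last by ring.
by rewrite cosD cosB; field.
Qed.

(** With l = 0 and d = 0 the cosine carried by the induction is the constant 1. *)
Lemma has_mean_prod_poly_sin (p : 'I_n -> {poly R}) :
  has_mean t0 (fun t => \prod_j (p j).[sin (w 0 j * t)])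
    (\prod_j sin_mean (p j)).
Proof.
have /choice[s sE] : forall j, exists s, (fun t => (p j).[sin t]) =1 trig_sum s /\
    sin_mean (p j) = trig_mean s.
  by move=> j; have [s h1 h2] := is_trig_poly_sin (p j); exists s.
have := @has_mean_prod_trig_cos (index_enum 'I_n) s 0 0 (index_enum_uniq _) _.
rewrite eqxx cos0 mulr1.
under [\prod_(_ <- _) trig_mean _]eq_bigr do rewrite -(sE _).2.
move=> H; apply: eq_has_mean (H _) => [t|j _]; last by rewrite ffunE.
have /eqP -> : freq 0 == 0 by rewrite freq_eq0.
rewrite mul0r add0r cos0 mulr1.
by apply: eq_bigr => j _; rewrite -(sE j).1.
Qed.

End equidistribution.

(** * Lebesgue measure on R^n: sigma-finiteness and Fubini *)

Section lebesgue_tuple.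
Context {R : realType}.
Local Notation mu := (@lebesgue_measure R).
Local Notation Rn n := (n.-tuple (measurableTypeR R)).

Lemma measurable_coord (n : nat) (i : 'I_n) :
  measurable_fun [set: Rn n] (fun u : Rn n => tnth u i : R).
Proof. exact: measurable_tnth. Qed.

Lemma measurable_box (n : nat) (a b : R) :
  measurable [set u : Rn n | forall i, a <= (tnth u i : R) <= b].
Proof.
rewrite (_ : [set _ | _] = \bigcap_(i in [set: 'I_n])
    (fun u : Rn n => tnth u i : R) @^-1` `[a, b]%classic); last first.
  apply/seteqP; split=> u /= h i; first by move=> _ /=; rewrite in_itv/= h.
  by have := h i Logic.I; rewrite /= in_itv.
apply: fin_bigcap_measurable => // i _.
by rewrite -[X in measurable X]setTI; exact: measurable_coord.
Qed.

Lemma measurable_cube n : measurable (@cube R n).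
Proof. exact: measurable_box. Qed.

Lemma preimage_tuple_cons_box (n : nat) (a b : R) :
  @tuple_cons R n @^-1` [set u | forall i, a <= (tnth u i : R) <= b] =
  `[a, b]%classic `*` [set u : Rn n | forall i, a <= (tnth u i : R) <= b].
Proof.
apply/seteqP; split=> -[x u] /=.
  move=> h; split; first by have := h ord0; rewrite in_itv tnth0.
  by move=> i; have := h (lift ord0 i); rewrite tnthS.
move=> [xab uab] i; rewrite in_itv/= in xab.
by case: (unliftP ord0 i) => [j|] ->; rewrite ?tnthS ?tnth0.
Qed.

Lemma lebesgue_tuple_box_lty n (a b : R) :
  (lebesgue_tuple R n [set u | forall i, (a <= (tnth u i : R) <= b)%R] < +oo)%E.
Proof.
elim: n => [|n IH] /=.
  by rewrite diracE; case: (_ \in _); rewrite ltry.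
rewrite /lebesgue_cons /pushforward preimage_tuple_cons_box.
rewrite product_measure2E//; last exact: measurable_box.
rewrite lte_mul_pinfty//.
have : (mu `[a, b] < +oo)%E.
  by rewrite lebesgue_measure_itv/=; case: ifP; rewrite ?ltry// -EFinB ltry.
by rewrite -ge0_fin_numE.
Qed.

Lemma lebesgue_tuple_sigma_finite n : sigma_finite setT (lebesgue_tuple R n).
Proof.
exists (fun k : nat => [set u : Rn n | forall i, - k%:R <= (tnth u i : R) <= k%:R]).
  apply/esym; rewrite -subTset => u _.
  have [k hk] : exists k : nat, forall i, `|tnth u i : R| <= k%:R.
    exists (\max_i Num.bound `|tnth u i : R|)%N => i.
    apply: (le_trans (ltW (archi_boundP (normr_ge0 _)))).
    by rewrite ler_nat; exact: leq_bigmax.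
  by exists k => // i; rewrite -ler_norml.
by move=> k; split; [exact: measurable_box|exact: lebesgue_tuple_box_lty].
Qed.

(* An alias carrying the sigma-finite structure. *)
Definition sf_lebesgue_tuple n : set (Rn n) -> \bar R := lebesgue_tuple R n.

HB.instance Definition _ n := Measure.copy (@sf_lebesgue_tuple n) (lebesgue_tuple R n).
HB.instance Definition _ n := @Measure_isSigmaFinite.Build _ _ _
  (@sf_lebesgue_tuple n) (@lebesgue_tuple_sigma_finite n).

(** The definition uses [\x^], which asks for sigma-finiteness of the one-dimensional factor only.
    Both products agree on rectangles, so uniqueness identifies it with [\x], for which the Fubini
    theorems are applied. *)
Lemma lebesgue_tupleS n (A : set (Rn n.+1)) : measurable A ->
  lebesgue_tuple R n.+1 A =
  pushforward (mu \x @sf_lebesgue_tuple n)%E (@tuple_cons R n) A.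
Proof.
move=> mA; rewrite /pushforward /=.
have mpA : measurable (@tuple_cons R n @^-1` A).
  by rewrite -[X in measurable X]setTI; exact: measurable_tuple_cons.
rewrite (product_measure_unique (m' := (mu \x^ @sf_lebesgue_tuple n)%E))//.
by move=> B C mB mC; exact: product_measure2E.
Qed.

Lemma ge0_integral_lebesgue_tupleS n (f : Rn n.+1 -> \bar R) :
  measurable_fun [set: Rn n.+1] f -> (forall u, (0 <= f u)%E) ->
  (\int[lebesgue_tuple R n.+1]_u f u =
   \int[mu]_x \int[lebesgue_tuple R n]_u f (tuple_cons (x, u)))%E.
Proof.
move=> mf f0.
have mcons := @measurable_tuple_cons R n.
pose m : {measure set _ -> \bar R} := pushforward (mu \x @sf_lebesgue_tuple n)%E (@tuple_cons R n).
transitivity (\int[m mcons]_u f u)%E.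
  by apply: eq_measure_integral => A mA _; exact: lebesgue_tupleS.
rewrite ge0_integral_pushforward//.
rewrite fubini_tonelli1//; last by move=> x; exact: f0.
exact: measurableT_comp.
Qed.

Lemma ge0_integral_lebesgue_tupleS_swap n (f : Rn n.+1 -> \bar R) :
  measurable_fun [set: Rn n.+1] f -> (forall u, (0 <= f u)%E) ->
  (\int[lebesgue_tuple R n.+1]_u f u =
   \int[lebesgue_tuple R n]_u \int[mu]_x f (tuple_cons (x, u)))%E.
Proof.
move=> mf f0; rewrite ge0_integral_lebesgue_tupleS//.
have mfc : measurable_fun [set: measurableTypeR R * Rn n] (f \o @tuple_cons R n).
  by apply: measurableT_comp => //; exact: measurable_tuple_cons.
exact: (fubini_tonelli (m1 := mu) (m2 := @sf_lebesgue_tuple n) (f \o @tuple_cons R n) mfc (fun x => f0 _)).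
Qed.

Lemma integral_lebesgue_tupleS n (f : Rn n.+1 -> \bar R) :
  (lebesgue_tuple R n.+1).-integrable setT f ->
  (\int[lebesgue_tuple R n.+1]_u f u =
   \int[mu]_x \int[lebesgue_tuple R n]_u f (tuple_cons (x, u)))%E.
Proof.
move=> intf.
have mf := measurable_int _ intf.
have mcons := @measurable_tuple_cons R n.
pose m : {measure set _ -> \bar R} := pushforward (mu \x @sf_lebesgue_tuple n)%E (@tuple_cons R n).
have intfc : (mu \x @sf_lebesgue_tuple n)%E.-integrable setT (f \o @tuple_cons R n).
  have mfc : measurable_fun [set: measurableTypeR R * Rn n] (f \o @tuple_cons R n).
    exact: measurableT_comp.
  apply/integrable12ltyP => //.
  have /integrableP[_] := intf.
  rewrite ge0_integral_lebesgue_tupleS//.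
  exact: measurableT_comp.
transitivity (\int[m mcons]_u f u)%E.
  by apply: eq_measure_integral => A mA _; exact: lebesgue_tupleS.
rewrite integral_pushforward//.
by rewrite -integral12_prod_meas1.
Qed.

End lebesgue_tuple.

(** * Integrals of products over the cube *)

Section product_integrals.
Context {R : realType}.
Local Notation mu := (@lebesgue_measure R).
Local Notation Rn n := (n.-tuple (measurableTypeR R)).

(** Integrability and value go through one induction: the value in dimension n + 1 uses Fubini,
    whose integrability condition comes from Tonelli applied to the absolute values of the
    factors. *)
Lemma prod_integrable_lebesgue_tuple n (g : 'I_n -> R -> R) :
  (forall j, mu.-integrable setT (EFin \o g j)) ->
  (lebesgue_tuple R n).-integrable setT
    (fun u : Rn n => (\prod_j g j (tnth u j))%:E) /\
  (\int[lebesgue_tuple R n]_u (\prod_j g j (tnth u j))%:E =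
   (\prod_j \int[mu]_x g j x)%:E)%E.
Proof.
move=> intg.
have mg j : measurable_fun [set: R] (g j).
  by apply/measurable_EFinP; have /integrableP[] := intg j.
have mprod m (h : 'I_m -> R -> R) : (forall j, measurable_fun [set: R] (h j)) ->
    measurable_fun [set: Rn m] (fun u => \prod_j h j (tnth u j)).
  move=> mh; apply: measurable_prod => j _.
  by apply: (measurableT_comp (mh j)); exact: measurable_coord.
elim: n g intg mg => [|n IH] g intg mg.
  under eq_fun do rewrite big_ord0.
  rewrite big_ord0 /= integral_dirac//= diracE in_setT mul1e; split=> //.
  apply/integrableP; split; first exact: measurable_cst.
  by rewrite integral_dirac//= diracE in_setT mul1e normr1 ltry.
have [int' val'] := IH (fun j => g (lift ord0 j)) (fun j => intg _) (fun j => mg _).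
have E (x : R) (u : Rn n) : \prod_j g j (tnth (tuple_cons (x, u)) j) =
    g ord0 x * \prod_(j < n) g (lift ord0 j) (tnth u j).
  by rewrite big_ord_recl tnth0; congr (_ * _); apply: eq_bigr => j _; rewrite tnthS.
have mpg := mprod _ _ mg.
have mpg' := mprod _ _ (fun j => mg (lift ord0 j)).
have intS : (lebesgue_tuple R n.+1).-integrable setT
    (fun u : Rn n.+1 => (\prod_j g j (tnth u j))%:E).
  apply/integrableP; split; first exact/measurable_EFinP.
  rewrite ge0_integral_lebesgue_tupleS//; last first.
    by apply: measurableT_comp => //; exact/measurable_EFinP.
  under eq_integral => x _.
    under eq_integral => u _ do rewrite E EFinM abseM.
    rewrite ge0_integralZl//; last first.
      by apply: measurableT_comp => //; exact/measurable_EFinP.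
    over.
  rewrite ge0_integralZr//.
  - have /integrableP[_ h1] := intg ord0.
    have /integrableP[_ h2] := int'.
    by rewrite lte_mul_pinfty// ?integral_ge0// ge0_fin_numE ?integral_ge0.
  - by apply: measurableT_comp => //; apply/measurable_EFinP; exact: mg.
  - exact: integral_ge0.
split=> //.
rewrite integral_lebesgue_tupleS//.
under eq_integral => x _.
  under eq_integral => u _ do rewrite E EFinM.
  rewrite integralZl// val'.
  over.
rewrite /= integralZr//; last exact: intg.
rewrite big_ord_recl EFinM; congr (_ * _)%E.
by rewrite /Rintegral fineK//; exact: (integrable_fin_num _ (intg ord0)).
Qed.

(** The indicator of the cube is the product of the indicators of [-1, 1], so each factor can be
    extended by zero to the whole line. *)
Lemma integral_prod_cube n (g : 'I_n -> R -> R) : (forall j, continuous (g j)) ->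
  (lebesgue_tuple R n).-integrable (@cube R n)
    (fun u : Rn n => (\prod_j g j (tnth u j))%:E) /\
  \int[lebesgue_tuple R n]_(u in @cube R n) (\prod_j g j (tnth u j)) =
   \prod_j \int[mu]_(x in `[-1, 1]) g j x.
Proof.
move=> cg.
have mc := @measurable_cube R n.
pose h j := (g j) \_ (`[-1, 1]%classic : set R).
have inth j : mu.-integrable setT (EFin \o h j).
  rewrite /h -restrict_EFin; apply: (integrable_mkcond _ _).1 => //.
  exact: continuous_integrable_itv.
have E : (fun u : Rn n => (\prod_j g j (tnth u j))%:E) \_ (@cube R n) =
    (fun u => (\prod_j h j (tnth u j))%:E).
  apply/funext => u; rewrite patchE; case: ifPn => [|uc].
    rewrite inE => uc; congr EFin; apply: eq_bigr => j _.
    by rewrite /h patchE mem_set//= in_itv/=; exact: uc.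
  have [j uj] : exists j : 'I_n, ~ (-1 <= (tnth u j : R) <= 1).
    by apply/existsNP; move: uc; rewrite notin_setE.
  rewrite (bigD1 j)//= /h patchE memNset ?mul0r//= in_itv/=.
have [int val] := prod_integrable_lebesgue_tuple inth.
split; first by apply: (integrable_mkcond _ _).2 => //; rewrite E.
rewrite /Rintegral integral_mkcond E val /=.
by apply: eq_bigr => j _; rewrite /Rintegral [in RHS]integral_mkcond restrict_EFin.
Qed.

Lemma kappaE n (u : Rn n) : kappa (rV_of_tuple u) =
  \prod_j (2 / pi * Num.sqrt (1 - (tnth u j : R) ^+ 2)).
Proof.
rewrite /kappa big_split/= prodr_const card_ord; congr (_ * _).
by apply: eq_bigr => j _; rewrite mxE.
Qed.

Definition map_tensor n (f : {poly R} -> {poly R}) (s : seq (R * ('I_n -> {poly R}))) :=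
  [seq (c.1, fun j => f (c.2 j)) | c <- s].

(** [kappa] is a product of semicircle densities, so smoothing acts on each factor separately and
    J_a of a product polynomial is again one. *)
Lemma integral_tensor_kappa n a (s : seq (R * ('I_n -> {poly R}))) (z : 'rV[R]_n) :
  (lebesgue_tuple R n).-integrable (@cube R n) (fun u =>
    (tensor s (z + a *: rV_of_tuple u) * kappa (rV_of_tuple u))%:E) /\
  Ja (tensor s) a z = tensor (map_tensor (smooth a) s) z.
Proof.
rewrite /Ja.
pose g (c : R * ('I_n -> {poly R})) (j : 'I_n) (x : R) :=
  (c.2 j).[z 0 j + a * x] * (2 / pi * Num.sqrt (1 - x ^+ 2)).
have cg c j : continuous (g c j).
  have ch : continuous (fun x => (c.2 j).[z 0 j + a * x]).
    apply: continuous_horner_comp => y; apply: cvgD; first exact: cvg_cst.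
    by apply: cvgM; [exact: cvg_cst|exact: cvg_id].
  move=> x; apply: cvgM; first exact: ch.
  by apply: cvgM; [exact: cvg_cst|exact: continuous_sqrt_weight].
have E (u : Rn n) : tensor s (z + a *: rV_of_tuple u) * kappa (rV_of_tuple u) =
    \sum_(c <- s) c.1 * \prod_j g c j (tnth u j).
  rewrite /tensor mulr_suml; apply: eq_bigr => c _.
  rewrite -mulrA kappaE -big_split/=; congr (_ * _); apply: eq_bigr => j _.
  by rewrite !mxE.
have G c := integral_prod_cube (cg c).
have val c : \prod_j \int[mu]_(x in `[-1, 1]) g c j x =
    \prod_j (smooth a (c.2 j)).[z 0 j].
  by apply: eq_bigr => j _; rewrite -integral_smooth.
under eq_fun do rewrite E.
under eq_Rintegral do rewrite E.
rewrite /tensor /map_tensor big_map; under [RHS]eq_bigr do rewrite -val.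
have mc := @measurable_cube R n.
elim: s {E} => [|c s [IH1 IH2]].
  under eq_fun do rewrite big_nil.
  under eq_Rintegral do rewrite big_nil.
  rewrite big_nil; split; first exact: integrable0.
  by rewrite Rintegral_cst// mul0r.
have [intc valc] := G c.
have intc' : (lebesgue_tuple R n).-integrable (@cube R n)
    (fun u => (c.1 * \prod_j g c j (tnth u j))%:E).
  by under eq_fun do rewrite EFinM; exact: integrableZl.
under eq_fun do rewrite big_cons.
under eq_Rintegral do rewrite big_cons.
split; first by under eq_fun do rewrite EFinD; exact: integrableD.
by rewrite RintegralD// IH2 RintegralZl// valc big_cons.
Qed.

End product_integrals.

(** * Integrating locally Lipschitz functions against kappa *)

Section lipschitz_integrable.
Context {R : realType} {n : nat}.
Local Notation Rn := (n.-tuple (measurableTypeR R)).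
Implicit Types (J : 'rV[R]_n -> R) (s : seq (R * ('I_n -> {poly R}))).

Lemma kappa_ge0 (u : 'rV[R]_n) : 0 <= kappa u.
Proof.
by rewrite /kappa mulr_ge0 ?prodr_ge0// exprn_ge0// divr_ge0// pi_ge0.
Qed.

Lemma integrable_kappa : (lebesgue_tuple R n).-integrable (@cube R n)
  (fun u : Rn => (kappa (rV_of_tuple u))%:E).
Proof.
under eq_fun do rewrite kappaE.
have [|//] := @integral_prod_cube R n (fun _ x => 2 / pi * Num.sqrt (1 - x ^+ 2)).
by move=> _ x; apply: cvgM; [exact: cvg_cst|exact: continuous_sqrt_weight].
Qed.

Lemma lipschitz_on_balls_affine J (a : R) (z : 'rV[R]_n) : lipschitz_on_balls J ->
  lipschitz_on_balls (fun u => J (z + a *: u)).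
Proof.
move=> lipJ M; have [L L0 hL] := lipJ (`|z| + `|a| * M).
exists (L * `|a|) => [|x y xM yM]; first exact: mulr_ge0.
have zM (v : 'rV[R]_n) : `|v| <= M -> `|z + a *: v| <= `|z| + `|a| * M.
  by move=> vM; apply: (le_trans (ler_normD _ _)); rewrite lerD2l normrZ ler_wpM2l.
apply: (le_trans (hL _ _ (zM _ xM) (zM _ yM))).
by rewrite opprD addrACA subrr add0r -scalerBr normrZ mulrA.
Qed.

Lemma lipschitz_on_balls_bounded J (M : R) : lipschitz_on_balls J ->
  exists2 B : R, 0 <= B & forall x, `|x| <= M -> `|J x| <= B.
Proof.
move=> lipJ; have [M0|M0] := leP 0 M; last first.
  by exists 0 => // x xM; have := le_lt_trans xM M0; rewrite normr_lt0.
have [L L0 hL] := lipJ M.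
exists (`|J 0| + L * M) => [|x xM]; first by rewrite addr_ge0// mulr_ge0.
rewrite -[J x](subrK (J 0)) addrC (le_trans (ler_normD _ _))// lerD2l.
apply: (le_trans (hL _ _ xM _)); first by rewrite normr0.
by rewrite subr0 ler_wpM2l.
Qed.

Lemma measurable_tensor s : measurable_fun [set: Rn] (fun u => tensor s (rV_of_tuple u)).
Proof.
apply: measurable_sum => c; apply: measurable_funM; first exact: measurable_cst.
apply: measurable_prod => j _.
under eq_fun do rewrite mxE.
apply: (@measurableT_comp _ _ _ _ _ _ (horner (c.2 j))); last exact: measurable_coord.
by apply: continuous_measurable_fun; exact: continuous_horner.
Qed.

(** The sigma-algebra is generated by the coordinates while J is controlled by a norm. Product
    polynomials bridge the two: they are measurable in the coordinates, and approximants of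
    precision 1 / (k + 1) on the ball of radius k converge to J pointwise. *)
Lemma measurable_lipschitz J : lipschitz_on_balls J ->
  measurable_fun [set: Rn] (fun u => J (rV_of_tuple u)).
Proof.
move=> lipJ.
have /choice[s hs] : forall k : nat, exists s, forall x, `|x| <= k%:R ->
    `|J x - tensor s x| <= k.+1%:R^-1.
  by move=> k; exact: tensor_approx.
apply: (@measurable_fun_cvg _ _ _ _ (fun k u => tensor (s k) (rV_of_tuple u))).
  by move=> k; exact: measurable_tensor.
move=> u _; apply/cvgrPdist_le => e e0.
near=> k; apply: (le_trans (hs k _ _)).
  by near: k; exact: nbhs_infty_ger.
by near: k; apply: filterS (near_infty_natSinv_lt (PosNum e0)) => i; exact: ltW.
Unshelve. all: by end_near. Qed.

Lemma cube_norm (u : Rn) : @cube R n u -> `|rV_of_tuple u| <= 1.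
Proof.
by move=> uc; apply: mx_norm_le => // i; rewrite mxE ler_norml; exact: uc.
Qed.

Lemma norm_affine_cube (x : 'rV[R]_n) (a M : R) (v : 'rV[R]_n) : 0 <= a ->
  `|x| <= M -> `|v| <= 1 -> `|x + a *: v| <= M + a.
Proof.
move=> a0 xM v1; apply: (le_trans (ler_normD _ _)); rewrite lerD// normrZ ger0_norm//.
by rewrite -[leRHS]mulr1 ler_wpM2l.
Qed.

Lemma integrableM_kappa (f : Rn -> R) (B : R) :
  measurable_fun (@cube R n) f -> (forall u, @cube R n u -> `|f u| <= B) ->
  (lebesgue_tuple R n).-integrable (@cube R n)
    (fun u => (f u * kappa (rV_of_tuple u))%:E).
Proof.
move=> mf fB.
under eq_fun do rewrite EFinM.
apply: integrableMr => //; first exact: measurable_cube; last exact: integrable_kappa.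
exists B; split; first exact: num_real.
by move=> x Bx u uc; exact: (le_trans (fB u uc) (ltW Bx)).
Qed.

Lemma integrable_lipschitz_kappa J (a : R) (z : 'rV[R]_n) : lipschitz_on_balls J ->
  (lebesgue_tuple R n).-integrable (@cube R n)
    (fun u : Rn => (J (z + a *: rV_of_tuple u) * kappa (rV_of_tuple u))%:E).
Proof.
move=> lipJ; have lipJ' := lipschitz_on_balls_affine a z lipJ.
have [B _ hB] := lipschitz_on_balls_bounded 1 lipJ'.
apply: (@integrableM_kappa (fun u => J (z + a *: rV_of_tuple u)) B) => [|u uc].
  by apply: (measurable_funS measurableT) => //; exact: measurable_lipschitz lipJ'.
exact/hB/cube_norm.
Qed.

Let K := \int[lebesgue_tuple R n]_(u in @cube R n) kappa (rV_of_tuple u).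

(** Integrability for [J2] is a hypothesis so that a product polynomial can stand there, with
    [integral_tensor_kappa] supplying it. [K] is the total mass of [kappa]. *)
Lemma Ja_dist J1 J2 (a : R) (x1 x2 : 'rV[R]_n) (e : R) :
  lipschitz_on_balls J1 ->
  (lebesgue_tuple R n).-integrable (@cube R n)
    (fun u : Rn => (J2 (x2 + a *: rV_of_tuple u) * kappa (rV_of_tuple u))%:E) ->
  (forall v : 'rV[R]_n, `|v| <= 1 -> `|J1 (x1 + a *: v) - J2 (x2 + a *: v)| <= e) ->
  `|Ja J1 a x1 - Ja J2 a x2| <= e * K.
Proof.
move=> lip1 int2 h12; have int1 := integrable_lipschitz_kappa a x1 lip1.
have mc := @measurable_cube R n.
rewrite /Ja -RintegralB//.
have intB : (lebesgue_tuple R n).-integrable (@cube R n) (fun u : Rn =>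
   (J1 (x1 + a *: rV_of_tuple u) * kappa (rV_of_tuple u) -
    J2 (x2 + a *: rV_of_tuple u) * kappa (rV_of_tuple u))%:E).
  by under eq_fun do rewrite EFinB; exact: integrableB.
apply: (le_trans (le_normr_Rintegral _ _)) => //.
rewrite /K -RintegralZl//; last exact: integrable_kappa.
apply: le_Rintegral => //.
- exact: integrable_norm.
- exact: (integrableZl mc e integrable_kappa).
move=> u uc; rewrite -mulrBl normrM (ger0_norm (kappa_ge0 _)) ler_wpM2r ?kappa_ge0//.
exact/h12/cube_norm.
Qed.

End lipschitz_integrable.

(** * Stability of time means under uniform approximation *)

Section mean_approximation.
Context {R : realType} (t0 : R).
Implicit Types (f h : R -> R).

Lemma has_mean_dist f h (c d e : R) : has_mean t0 f c -> has_mean t0 h d ->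
  (forall t, `|f t - h t| <= e) -> `|c - d| <= e.
Proof.
move=> [cf fc] [ch hd] fh.
have cfh : continuous (fun t => f t + -1 * h t).
  by move=> t; apply: cvgD; [exact: cf|apply: cvgM; [exact: cvg_cst|exact: ch]].
have cv : `|time_mean t0 f T - time_mean t0 h T| @[T --> +oo] --> `|c - d|.
  by apply: cvg_norm; exact: cvgB.
apply: (cvgr_to_le cv); near=> T.
have T0 : 0 < T by near: T; apply: nbhs_pinfty_gt; exact: num_real.
rewrite -mulN1r -time_meanZ// -time_meanD//; last first.
  by move=> t; apply: cvgM; [exact: cvg_cst|exact: ch].
by apply: time_mean_bound => // t; rewrite mulN1r.
Unshelve. all: by end_near. Qed.

(** A uniform error e changes every time mean by at most e, uniformly in T > 0, so the time means of
    f are eventually near d. This makes them Cauchy as T grows. *)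
Lemma has_mean_approx f :
  (forall e, 0 < e -> exists h d, has_mean t0 h d /\ forall t, `|f t - h t| <= e) ->
  exists c, has_mean t0 f c.
Proof.
move=> approx.
have cf : continuous f.
  move=> x; apply/cvgrPdist_le => e e0.
  have [|h [d [[ch _] fh]]] := approx (e / 3); first by rewrite divr_gt0.
  have /cvgrPdist_le/(_ (e / 3)) := ch x; rewrite divr_gt0// => /(_ isT).
  apply: filterS => y hxy.
  rewrite (_ : f x - f y = (f x - h x) + (h x - h y) + - (f y - h y)); last by ring.
  apply: (le_trans (ler_normD _ _)); rewrite normrN.
  rewrite (_ : e = (e / 3 + e / 3) + e / 3); last by field.
  by rewrite lerD// (le_trans (ler_normD _ _))// lerD.
suff /cvg_ex[c fc] : cvg (time_mean t0 f T @[T --> +oo]) by exists c.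
apply/cauchy_cvgP/cauchy_exP => e e0.
have [|h [d [[ch hd] fh]]] := approx (e / 2); first by rewrite divr_gt0.
exists d.
have /cvgrPdist_lt/(_ (e / 2)) := hd; rewrite divr_gt0// => /(_ isT) hd'.
suff : \forall T \near +oo, ball d e (time_mean t0 f T) by [].
near=> T.
have T0 : 0 < T by near: T; apply: nbhs_pinfty_gt; exact: num_real.
rewrite /ball /=.
rewrite (_ : d - time_mean t0 f T = (d - time_mean t0 h T) +
   - (time_mean t0 f T - time_mean t0 h T)); last by ring.
rewrite (le_lt_trans (ler_normD _ _))// normrN (_ : e = e / 2 + e / 2); last by field.
apply: ltr_leD; first by near: T.
rewrite -mulN1r -time_meanZ// -time_meanD//; last first.
  by move=> t; apply: cvgM; [exact: cvg_cst|exact: ch].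
apply: time_mean_bound => // [t|t]; last by rewrite mulN1r.
by apply: cvgD; [exact: cf|apply: cvgM; [exact: cvg_cst|exact: ch]].
Unshelve. all: by end_near. Qed.

End mean_approximation.

(** * Time mean of F *)

Section esF_means.
Context {R : realType} {n : nat} (a : R) (w : 'rV[R]_n) (t0 : R).
Hypotheses (a_gt0 : 0 < a) (w_indep : rationally_independent w).
Implicit Types (J : 'rV[R]_n -> R) (s : seq (R * ('I_n -> {poly R}))).

Definition deriv_tensor (i : 'I_n) s : seq (R * ('I_n -> {poly R})) :=
  [seq (c.1, fun j => if j == i then (c.2 j)^`() else c.2 j) | c <- s].

Lemma deriv_map_smooth i s :
  deriv_tensor i (map_tensor (smooth a) s) = map_tensor (smooth a) (deriv_tensor i s).
Proof.
rewrite /deriv_tensor /map_tensor -!map_comp; apply: eq_map => c /=.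
by congr (_, _); apply/funext => j; case: ifP => // _; rewrite deriv_smooth.
Qed.

(** In [P], X stands for sin and 1 - X^2 for cos^2. Every coordinate yields 1/2 times a smoothed
    factor, and coordinate i also yields a and a derivative. *)
Lemma has_mean_esF_tensor s (z : 'rV[R]_n) i :
  has_mean t0 (fun t => esF (tensor s) a z (t *: w) 0 i)
    (- tensor (deriv_tensor i (map_tensor (smooth a) s)) z).
Proof.
rewrite deriv_map_smooth.
pose P (c : R * ('I_n -> {poly R})) j : {poly R} :=
  (if j == i then 'X else 1 - 'X^2) * (c.2 j \Po ((z 0 j)%:P + a *: 'X)).
have := @has_mean_sum R t0 _ s _ _ (fun c =>
  has_meanZ (- (2 ^+ n / a) * c.1) (has_mean_prod_poly_sin t0 w_indep (P c))).
have a0 : a != 0 by rewrite gt_eqF.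
have -> : \sum_(c <- s) - (2 ^+ n / a) * c.1 * (\prod_j sin_mean (P c j)) =
    - tensor (map_tensor (smooth a) (deriv_tensor i s)) z.
  rewrite /tensor /map_tensor /deriv_tensor !big_map -sumrN; apply: eq_bigr => c _ /=.
  have -> : \prod_j sin_mean (P c j) = \prod_j ((if j == i then a else 1) * 2^-1 *
      (smooth a (if j == i then (c.2 j)^`() else c.2 j)).[z 0 j]).
    apply: eq_bigr => j _; rewrite /P; case: ifP => _.
      by rewrite [RHS]mulrAC -sin_mean_smooth_deriv [RHS]mulrC mulKf.
    by rewrite smoothE /semicircle_mean mul1r mulKf.
  rewrite big_split/= big_split/= -big_mkcond/= big_pred1_eq prodr_const card_ord.
  by rewrite exprVn; field; rewrite a0 expf_neq0.
apply: eq_has_mean => t; rewrite mxE /tensor mulr_sumr !mulr_suml.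
apply: eq_bigr => c _.
have -> : \prod_j (P c j).[sin (w 0 j * t)] =
    (\prod_j (c.2 j).[(z + a *: map_mx sin (t *: w)) 0 j]) *
    (sin ((t *: w) 0 i) * \prod_(j < n | j != i) cos ((t *: w) 0 j) ^+ 2).
  transitivity (\prod_j ((if j == i then sin ((t *: w) 0 j) else cos ((t *: w) 0 j) ^+ 2) *
      (c.2 j).[(z + a *: map_mx sin (t *: w)) 0 j])).
    apply: eq_bigr => j _; rewrite /P hornerM horner_comp !mxE [w 0 j * t]mulrC.
    congr (_ * _); last by rewrite !hornerE.
    by case: ifP => _; rewrite !hornerE// cos2sin2.
  rewrite big_split/= mulrC; congr (_ * _).
  rewrite (bigD1 i)//= eqxx; congr (_ * _).
  by apply: eq_bigr => j /negbTE ->.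
by rewrite !mulrA.
Qed.

(** With equal centers this transports an approximation of J to F; with equal functions it makes the
    mean of F Lipschitz in its center. *)
Lemma esF_dist J1 J2 (z1 z2 theta : 'rV[R]_n) (i : 'I_n) (e : R) :
  (forall v : 'rV[R]_n, `|v| <= 1 -> `|J1 (z1 + a *: v) - J2 (z2 + a *: v)| <= e) ->
  `|esF J1 a z1 theta 0 i - esF J2 a z2 theta 0 i| <= 2 ^+ n / a * e.
Proof.
move=> h12; rewrite !mxE.
set k := 2 ^+ n / a; set c := \prod_(_ < _ | _) _; set v := map_mx sin theta.
have k0 : 0 <= k by rewrite divr_ge0// ?exprn_ge0// ltW.
have c1 : `|c| <= 1.
  rewrite /c normr_prod; apply: prodr_ile1 => j _.
  rewrite normr_ge0/= normrX expr_le1//; exact: cos_max.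
rewrite (_ : _ - _ = - (k * (J1 (z1 + a *: v) - J2 (z2 + a *: v)) * (sin (theta 0 i) * c))); last by ring.
rewrite normrN normrM -[leRHS]mulr1 ler_pM//.
  rewrite normrM ger0_norm// ler_wpM2l// h12//.
  by apply: mx_norm_le => // j; rewrite mxE sin_max.
by rewrite normrM mulr_ile1// sin_max.
Qed.

Lemma has_mean_esF J z i : lipschitz_on_balls J ->
  exists c, has_mean t0 (fun t => esF J a z (t *: w) 0 i) c.
Proof.
move=> lipJ; apply: has_mean_approx => e e0.
have k0 : 0 < 2 ^+ n / a :> R by rewrite divr_gt0// exprn_gt0.
have [|s hs] := tensor_approx (`|z| + a) lipJ (_ : 0 < e / (2 ^+ n / a)).
  by rewrite divr_gt0.
exists (fun t => esF (tensor s) a z (t *: w) 0 i); eexists; split.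
  exact: has_mean_esF_tensor.
move=> t; rewrite -[leRHS](divfK (lt0r_neq0 k0)) [leRHS]mulrC.
by apply: esF_dist => v v1; apply: hs; apply: norm_affine_cube => //; exact: ltW.
Qed.

End esF_means.

(** * Mean value theorem for product polynomials and a differentiability criterion *)

Section tensor_derivative.
Context {R : realType} {n : nat}.
Implicit Types (s : seq (R * ('I_n -> {poly R}))).

Lemma deriv_prod_uniq (I : eqType) (r : seq I) (P : I -> {poly R}) : uniq r ->
  (\prod_(j <- r) P j)^`() =
  \sum_(i <- r) \prod_(j <- r) (if j == i then (P j)^`() else P j).
Proof.
elim: r => [|k r IH] /=; first by rewrite !big_nil derivC.
move=> /andP[kr ur]; rewrite !big_cons derivM IH// eqxx mulr_sumr; congr (_ + _).
  congr (_ * _); apply: eq_big_seq => j jr.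
  by case: eqP => // jk; rewrite -jk jr in kr.
apply: eq_big_seq => i ir; rewrite big_cons.
by case: eqP => // ki; rewrite ki ir in kr.
Qed.

(** Along the segment from x to x + h a product polynomial is a polynomial in one variable, whose
    formal derivative is computed factor by factor. *)
Lemma tensor_MVT s (x h : 'rV[R]_n) :
  exists2 c : R, 0 <= c <= 1 & tensor s (x + h) - tensor s x =
    \sum_i h 0 i * tensor (deriv_tensor i s) (x + c *: h).
Proof.
pose q c (j : 'I_n) : {poly R} := c j \Po ((x 0 j)%:P + (h 0 j) *: 'X).
pose Q : {poly R} := \sum_(c <- s) c.1 *: \prod_j q c.2 j.
have qE c j t : (q c j).[t] = (c j).[(x + t *: h) 0 j].
  by rewrite horner_comp !hornerE !mxE mulrC.
have QE t : Q.[t] = tensor s (x + t *: h).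
  rewrite horner_sum; apply: eq_bigr => c _; rewrite hornerZ horner_prod.
  by congr (_ * _); apply: eq_bigr => j _; rewrite qE.
have Q'E t : Q^`().[t] = \sum_i h 0 i * tensor (deriv_tensor i s) (x + t *: h).
  under [RHS]eq_bigr do rewrite /tensor /deriv_tensor big_map mulr_sumr.
  rewrite exchange_big /= raddf_sum horner_sum; apply: eq_bigr => c _ /=.
  rewrite derivZ hornerZ deriv_prod_uniq ?index_enum_uniq// horner_sum mulr_sumr.
  apply: eq_bigr => i _; rewrite horner_prod [RHS]mulrCA; congr (_ * _).
  transitivity (\prod_j ((if j == i then h 0 i else 1) *
      (if j == i then (c.2 j)^`() else c.2 j).[(x + t *: h) 0 j])).
    apply: eq_bigr => j _; case: eqP => [->|_]; last by rewrite mul1r qE.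
    rewrite deriv_comp hornerM derivD derivC derivZ derivX add0r.
    rewrite alg_polyC hornerC mulrC; congr (_ * _).
    by rewrite horner_comp !hornerE !mxE [h 0 i * _]mulrC.
  by rewrite big_split/= -big_mkcond/= big_pred1_eq.
have [c c01] := @MVT R (horner Q) (horner Q^`()) 0 1 ltr01
  (fun t _ => is_derive_poly Q t) (continuous_subspaceT (@continuous_horner _ Q)).
rewrite !QE scale1r scale0r addr0 Q'E subr0 mulr1 => ->.
exists c => //; move: c01; rewrite in_itv/= => /andP[c0 c1].
by rewrite !ltW.
Qed.

End tensor_derivative.

Section differentiability.
Context {R : realType}.

Lemma differentiable_quadratic (V W : normedModType R) (f : V -> W)
    (df : {linear V -> W}) (x : V) (C : R) :
  continuous df ->
  (forall h, `|h| <= 1 -> `|f (x + h) - f x - df h| <= C * `|h| ^+ 2) ->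
  differentiable f x /\ 'd f x = df :> (V -> W).
Proof.
move=> cdf hf.
have hdx : f \o shift x = cst (f x) + df +o_ 0 id.
  apply/eqaddoP => _/posnumP[e].
  pose C' := `|C| + 1.
  have C'0 : 0 < C' by rewrite ltr_wpDl.
  near=> h.
  have h1 : `|h| <= 1.
    by rewrite ltW//; near: h; exact: nbhs0_lt.
  have h2 : `|h| <= e%:num / C'.
    by rewrite ltW//; near: h; apply: nbhs0_lt; rewrite divr_gt0.
  have := hf h h1; rewrite [x + h]addrC => hfh.
  rewrite -[X in `|X| <= _]/(f (h + x) - (f x + df h)) opprD addrA.
  apply: (le_trans hfh).
  rewrite expr2 mulrA ler_wpM2r//.
  rewrite (le_trans (ler_wpM2r (normr_ge0 h) (_ : C <= C')))//.
    by rewrite (le_trans (ler_norm _))// lerDl.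
  by rewrite mulrC -ler_pdivlMr.
have dE := diff_unique cdf hdx.
by split=> //; apply/diff_locallyP; rewrite dE.
Unshelve. all: by end_near. Qed.

Lemma differentiable_quadratic_rV (n : nat) (f : 'rV[R]_n -> R) (x g : 'rV[R]_n) (C : R) :
  (forall h : 'rV[R]_n, `|h| <= 1 ->
    `|f (x + h) - f x - \sum_i h 0 i * g 0 i| <= C * `|h| ^+ 2) ->
  differentiable f x /\ forall i, 'D_(unit_vec R i) f x = g 0 i.
Proof.
move=> hf.
pose df (h : 'rV[R]_n) : R^o := \sum_i h 0 i * g 0 i.
have df_lin : linear df.
  move=> k u v; rewrite /df /GRing.scale/= mulr_sumr -big_split; apply: eq_bigr => i _ /=.
  by rewrite !mxE; ring.
pose dfL : {linear 'rV[R]_n -> R^o} := HB.pack df (GRing.isLinear.Build _ _ _ _ _ df_lin).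
have cdf : continuous dfL.
  rewrite /dfL /= /df; elim: (index_enum _) => [|i r IH].
    by under eq_fun do rewrite big_nil; exact: cst_continuous.
  under eq_fun do rewrite big_cons.
  move=> u; apply: (@continuousD _ _ _ (fun h : 'rV[R]_n => h 0 i * g 0 i) _ u);
    last exact: IH.
  apply: (@continuousM _ _ (fun h : 'rV[R]_n => h 0 i) (cst (g 0 i)) u).
    exact: coord_continuous.
  exact: cst_continuous.
have [fx dE] := differentiable_quadratic cdf hf.
split=> // i; rewrite deriveE// dE /= /df (bigD1 i)//= !mxE !eqxx mul1r.
by rewrite big1 ?addr0// => j /negbTE ij; rewrite !mxE ij andbF mul0r.
Qed.

End differentiability.

(** * The mean of F is minus the gradient of J_a *)

Section gradient_of_Ja.
Context {R : realType} {n : nat} (J : 'rV[R]_n -> R) (a : R) (w : 'rV[R]_n) (t0 : R).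
Hypotheses (lipJ : lipschitz_on_balls J) (a_gt0 : 0 < a).
Hypothesis (w_indep : rationally_independent w).

(** [G] is chosen as minus a limit of windows starting at [t0]; the second clause shows that it does
    not depend on [t0]. *)
Lemma Ja_gradient : exists G : 'I_n -> 'rV[R]_n -> R,
  (forall i z, has_mean t0 (fun t => esF J a z (t *: w) 0 i) (- G i z)) /\
  (forall x, differentiable (Ja J a) x /\
    forall i, 'D_(unit_vec R i) (Ja J a) x = G i x).
Proof.
have /choice[G0 hG0] : forall p : 'I_n * 'rV[R]_n,
    exists c, has_mean t0 (fun t => esF J a p.2 (t *: w) 0 p.1) c.
  by move=> p; exact: has_mean_esF.
pose G i z := - G0 (i, z).
have hG i z : has_mean t0 (fun t => esF J a z (t *: w) 0 i) (- G i z).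
  by rewrite /G opprK; exact: (hG0 (i, z)).
exists G; split=> // x.
(* G x is only known as a limit, so the quadratic bound is proved up to e' by
   the mean value theorem for a product polynomial e-close to J. *)
suff [C hC] : exists C, forall h : 'rV[R]_n, `|h| <= 1 ->
    `|Ja J a (x + h) - Ja J a x - \sum_i h 0 i * G i x| <= C * `|h| ^+ 2.
  have [|fx DE] := @differentiable_quadratic_rV _ n (Ja J a) x (\row_i G i x) C.
    by move=> h h1; under eq_bigr do rewrite mxE; exact: hC.
  by split=> // i; rewrite DE mxE.
pose M := `|x| + 1.
have [L L0 hL] := lipJ (M + a).
pose k : R := 2 ^+ n / a.
have k0 : 0 <= k by rewrite divr_ge0// ?exprn_ge0// ltW.
pose K := \int[lebesgue_tuple R n]_(u in @cube R n) kappa (rV_of_tuple u).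
have K0 : 0 <= K by apply: Rintegral_ge0 => u _; exact: kappa_ge0.
have Glip i (y : 'rV[R]_n) : `|y| <= M -> `|G i y - G i x| <= k * (L * `|y - x|).
  move=> yM; have xM : `|x| <= M by rewrite lerDl.
  rewrite -[leLHS]normrN opprD.
  apply: (has_mean_dist (hG i y) (hG i x)) => t.
  apply: esF_dist => // v v1.
  apply: (le_trans (hL _ _ _ _)); try by apply: norm_affine_cube => //; exact: ltW.
  by rewrite opprD addrACA subrr addr0.
have budget (E K' m k' H L' : R) :
    E * K' + E * K' + m * (H * (k' * E + k' * (L' * H))) =
    m * (k' * L') * H ^+ 2 + E * (2 * K' + m * (k' * H)) by ring.
exists (n%:R * (k * L)) => h h1.
apply/ler_addgt0Pr => e' e'0.
(* [D] collects what multiplies e in the total error: e K for each of the two values of J_a, and k e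
   |h| for each of the n partial derivatives. *)
pose D := 2 * K + n%:R * (k * `|h|).
have D0 : 0 <= D by apply: addr_ge0; do ?apply: mulr_ge0 => //.
pose e := e' / (D + 1).
have e0 : 0 < e by rewrite divr_gt0// ltr_wpDl.
have eD : e * D <= e'.
  by rewrite /e mulrAC ler_pdivrMr ?ltr_wpDl// ler_pM2l// lerDl.
have [s hs] := tensor_approx (M + a) lipJ e0.
pose S := map_tensor (smooth a) s.
have FE y : Ja (tensor s) a y = tensor S y := (integral_tensor_kappa a s y).2.
have ints y := (integral_tensor_kappa a s y).1.
have hsv (y v : 'rV[R]_n) : `|y| <= M -> `|v| <= 1 ->
    `|J (y + a *: v) - tensor s (y + a *: v)| <= e.
  by move=> yM v1; apply: hs; apply: norm_affine_cube => //; exact: ltW.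
have JF (y : 'rV[R]_n) : `|y| <= M -> `|Ja J a y - tensor S y| <= e * K.
  by move=> yM; rewrite -FE; apply: Ja_dist => // v v1; exact: hsv.
have GF i (y : 'rV[R]_n) : `|y| <= M -> `|G i y - tensor (deriv_tensor i S) y| <= k * e.
  move=> yM; rewrite -normrN opprD.
  apply: (has_mean_dist (hG i y) (has_mean_esF_tensor t0 a_gt0 w_indep s y i)) => t.
  by apply: esF_dist => // v v1; exact: hsv.
have xhM (c : R) : 0 <= c <= 1 -> `|x + c *: h| <= M.
  move=> /andP[c0 c1]; rewrite (le_trans (ler_normD _ _))// lerD2l normrZ ger0_norm//.
  by rewrite mulr_ile1.
have [c c01 mvt] := tensor_MVT S x h.
have xM : `|x| <= M by rewrite lerDl.
have xh1 : `|x + h| <= M by have := xhM 1; rewrite scale1r lexx ler01; exact.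
rewrite (_ : Ja J a (x + h) - Ja J a x - _ =
  (Ja J a (x + h) - tensor S (x + h)) + (- (Ja J a x - tensor S x)) +
  (tensor S (x + h) - tensor S x - \sum_i h 0 i * G i x)); last by ring.
rewrite mvt -sumrB.
have sumle : `|\sum_i (h 0 i * tensor (deriv_tensor i S) (x + c *: h) - h 0 i * G i x)| <=
    n%:R * (`|h| * (k * e + k * (L * `|h|))).
  apply: (le_trans (ler_norm_sum _ _ _)).
  apply: (le_trans (ler_sum _ (G := fun=> `|h| * (k * e + k * (L * `|h|))) _)).
    move=> i _; rewrite -mulrBr normrM ler_pM// ?mx_norm_coord//.
    rewrite (_ : _ - G i x = - (G i (x + c *: h) - tensor (deriv_tensor i S) (x + c *: h)) +
      (G i (x + c *: h) - G i x)); last by ring.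
    rewrite (le_trans (ler_normD _ _))// normrN lerD//; first exact/GF/xhM.
    apply: (le_trans (Glip _ _ (xhM _ c01))).
    rewrite addrAC subrr add0r !ler_wpM2l// normrZ.
    case/andP: c01 => c0 c1; rewrite ger0_norm//.
    by rewrite -[leRHS]mul1r ler_wpM2r.
  by rewrite sumr_const card_ord mulr_natl.
apply: (le_trans (ler_normD _ _)).
apply: (le_trans (lerD (ler_normD _ _) sumle)).
rewrite normrN.
apply: (le_trans (lerD (lerD (JF _ xh1) (JF _ xM)) (lexx _))).
apply: (@le_trans _ _ (n%:R * (k * L) * `|h| ^+ 2 + e * D)); last by rewrite lerD2l.
rewrite le_eqVlt; apply/orP; left; apply/eqP; rewrite /D.
exact: budget.
Qed.

End gradient_of_Ja.

(** * Almost everywhere derivability in one variable *)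

Section lipschitz_ae_derivable.
Context {R : realType}.
Local Notation mu := (@lebesgue_measure R).

Section nondecreasing.
Variables (g : cumulative R R) (c : R).
Hypotheses (c_ge0 : 0 <= c) (g_lip : forall x y, x <= y -> g y - g x <= c * (y - x)).

Let nu := lebesgue_stieltjes_measure g.

(** A Lebesgue null set is covered by half-open intervals of total length below e / (c + 1), and
    [nu] of an interval is at most c times its length. *)
Let nu_dominated : nu `<< mu.
Proof.
apply/null_content_dominatesP => A mA muA0; apply/eqP.
rewrite -measure_le0; apply/lee_addgt0Pr => e e0; rewrite add0e.
have ec : 0 < e / (c + 1) by rewrite divr_gt0// ltr_wpDl.
have : (mu A < (e / (c + 1))%:E)%E by rewrite muA0 lte_fin.
rewrite {1}/lebesgue_measure /lebesgue_stieltjes_measure /measure_extension /mu_ext.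
move=> /ereal_inf_lt[_ [F [mF AF] <-]] hF.
apply: (@le_trans _ _ (\sum_(k <oo) wlength g (F k))%E).
  by apply: ereal_inf_lbound; exists F.
have le1 k : (wlength g (F k) <= c%:E * wlength idfun (F k))%E.
  have /ocitvP[->|[[x y]/= xy ->]] := mF k; first by rewrite !wlength0 mule0.
  rewrite !(wlength_itv_bnd _ _ _ (ltW xy))/=.
  by rewrite -EFinM lee_fin g_lip// ltW.
apply: (@le_trans _ _ (\sum_(k <oo) c%:E * wlength idfun (F k))%E).
  by apply: lee_nneseries => // k _; exact: wlength_ge0.
rewrite nneseriesZl//.
apply: (@le_trans _ _ (c%:E * (e / (c + 1))%:E)%E).
  by apply: lee_wpmul2l; rewrite ?lee_fin// ltW.
by rewrite -EFinM lee_fin mulrCA ler_piMr ?(ltW e0)// ler_pdivrMr ?ltr_wpDl// mul1r lerDl.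
Qed.

Let nu_itv x y : x <= y -> nu `]x, y]%classic = (g y - g x)%:E.
Proof.
move=> xy; rewrite /nu /lebesgue_stieltjes_measure /measure_extension/=.
by rewrite measurable_mu_extE/= ?wlength_itv_bnd//; exact: is_ocitv.
Qed.

Lemma ae_derivable_cumulative a b :
  {ae mu, forall x, a < x < b -> derivable g x 1}.
Proof.
have [ba|ab] := leP b a.
  apply: aeW => x /andP[ax xb]; have := lt_trans ax xb; by rewrite ltNge ba.
pose D := `]a, b]%classic : set (measurableTypeR R).
have mD : measurable D by exact: measurable_itv.
have nuD : (nu D < +oo)%E by rewrite /D nu_itv ?ltW// ltry.
(* Restricting [nu] to [D] makes it finite, so that its density is integrable on the line. *)
pose m : {finite_measure set (measurableTypeR R) -> \bar R} := mfrestr mD nuD.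
have m_dom : m `<< mu.
  apply/null_content_dominatesP => A mA muA0.
  apply: ((null_content_dominatesP _ _).1 nu_dominated); first exact: measurableI.
  apply/eqP; rewrite -measure_le0 -muA0; apply: le_measure; rewrite ?inE//.
  exact: measurableI.
have [h [h0 hfin inth hE]] := radon_nikodym_sigma_finite m_dom.
pose H x := fine (h x).
have HE : EFin \o H = h by apply/funext => x /=; rewrite fineK.
have intH : mu.-integrable setT (EFin \o H) by rewrite HE.
have FE y : a <= y <= b -> \int[mu]_(t in `]a, y]) H t = g y - g a.
  move=> /andP[ay yb]; rewrite /Rintegral.
  under eq_integral do rewrite -[(H _)%:E]/((EFin \o H) _) HE.
  rewrite -hE//.
  rewrite /m/= /mfrestr /mrestr (_ : _ `&` D = `]a, y]%classic).
    exact: (congr1 fine (nu_itv ay)).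
  apply/setIidl => t /=; rewrite !in_itv/= => /andP[xt ty].
  by apply/andP; split=> //; exact: le_trans yb.
have locH : locally_integrable setT H.
  by apply: open_integrable_locally => //; exact: openT.
have := lebesgue_differentiation locH.
apply: filterS; first exact: (ae_filter_ringOfSetsType mu).
move=> x Hx /andP[ax xb].
have intHb : mu.-integrable [set` Interval (BRight a) (BRight b)] (EFin \o H).
  exact: (integrableS measurableT).
have ax' : (BRight a < BRight x)%O by rewrite bnd_simp.
have [dF _] := FTC1_lebesgue_pt xb intHb ax' Hx.
(* By [FE], [F] coincides with [g] on a neighbourhood of x. *)
pose F y := \int[mu]_(t in `]a, y]) H t + g a.
apply: (@near_eq_derivable _ _ _ F).
  near=> y; rewrite /F FE ?subrK//; apply/andP; split.
    by rewrite ltW//; near: y; exact: lt_nbhsr.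
  by rewrite ltW//; near: y; exact: lt_nbhsl.
by apply: derivableD.
Unshelve. all: by end_near. Qed.

End nondecreasing.

(** Clamping the argument to [-M, M] makes f Lipschitz on the whole line, and adding L times the
    clamp compensates its steepest descent. The increments then lie between 0 and 2 L (y - x), and
    inside the interval the clamp is the identity. *)
Let ae_derivable_itv (f : R -> R) (M L : R) : 0 <= M -> 0 <= L ->
  (forall x y, `|x| <= M -> `|y| <= M -> `|f x - f y| <= L * `|x - y|) ->
  {ae mu, forall x, - M < x < M -> derivable f x 1}.
Proof.
move=> M0 L0 fL.
pose cl (t : R) := Num.max (- M) (Num.min M t).
have cl_cases t : [\/ t <= - M /\ cl t = - M, - M <= t <= M /\ cl t = t |
    M <= t /\ cl t = M].
  have [h1|h1] := leP M t.
    apply: Or33; split=> //; rewrite /cl min_l// max_r//; lra.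
  have [h2|h2] := leP t (- M).
    by apply: Or31; split=> //; rewrite /cl min_r ?(ltW h1)// max_l.
  by apply: Or32; rewrite (ltW h1) (ltW h2); split=> //; rewrite /cl min_r ?(ltW h1)// max_r// ltW.
have clM t : `|cl t| <= M.
  rewrite ler_norml.
  by case: (cl_cases t) => [[h1 ->]|[/andP[h1 h2] ->]|[h1 ->]]; apply/andP; split; lra.
have cl_id t : - M < t < M -> cl t = t.
  move=> /andP[t1 t2].
  by case: (cl_cases t) => [[h1 ->]|[/andP[h1 h2] ->]|[h1 ->]]; lra.
have cl_nd x y : x <= y -> 0 <= cl y - cl x <= y - x.
  move=> xy; case: (cl_cases x) => [[h1 ->]|[/andP[h1 h2] ->]|[h1 ->]];
  case: (cl_cases y) => [[h3 ->]|[/andP[h3 h4] ->]|[h3 ->]];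
  by apply/andP; split; lra.
pose g t := f (cl t) + L * cl t.
have gxy x y : x <= y -> 0 <= g y - g x <= 2 * L * (y - x).
  move=> xy; have /andP[c0 c1] := cl_nd _ _ xy.
  have := fL _ _ (clM y) (clM x); rewrite (ger0_norm c0) ler_norml => /andP[h1 h2].
  have h3 : L * (cl y - cl x) <= L * (y - x) by rewrite ler_wpM2l.
  rewrite (_ : g y - g x = (f (cl y) - f (cl x)) + L * (cl y - cl x)); last by rewrite /g; ring.
  by apply/andP; split; lra.
have g_nd : nondecreasing g.
  by move=> x y xy; have /andP[] := gxy _ _ xy; rewrite subr_ge0.
have cg : continuous g.
  have L1 : 0 < 2 * L + 1 by rewrite ltr_wpDl// mulr_ge0.
  move=> x; apply/cvgrPdist_le => e e0; near=> y.
  have gle : `|g x - g y| <= 2 * L * `|x - y|.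
    have [xy|/ltW yx] := leP x y.
      by rewrite distrC [`|x - y|]distrC !ger0_norm ?subr_ge0 ?g_nd//; have /andP[] := gxy _ _ xy.
    by rewrite !ger0_norm ?subr_ge0 ?g_nd//; have /andP[] := gxy _ _ yx.
  apply: (le_trans gle).
  have h : `|x - y| <= e / (2 * L + 1).
    near: y; have /cvgrPdist_le := @cvg_id _ (nbhs x); apply.
    by rewrite divr_gt0.
  apply: (@le_trans _ _ ((2 * L + 1) * (e / (2 * L + 1)))).
    by rewrite ler_pM// ?mulr_ge0// lerDl.
  by rewrite mulrCA divff ?mulr1// gt_eqF.
have g_rc : right_continuous g by exact: right_continuousW.
pose gc : cumulative R R := HB.pack g (isCumulative.Build R _ R g g_nd g_rc).
have := @ae_derivable_cumulative gc (2 * L) (mulr_ge0 (ler0n _ 2) L0)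
  (fun x y xy => proj2 (andP (gxy x y xy))) (- M) M.
apply: filterS; first exact: (ae_filter_ringOfSetsType mu).
move=> x dg /[dup] xM /dg {}dg.
apply: (@near_eq_derivable _ _ _ (fun t => g t + (- L) * t)).
  have : x \in `]- M, M[ by rewrite in_itv.
  move=> /near_in_itvoo; apply: filterS => y; rewrite in_itv/= => yM.
  by rewrite /g cl_id//; ring.
by apply: derivableD => //; apply: derivableM.
Unshelve. all: by end_near. Qed.

Lemma lipschitz_ae_derivable (f : R -> R) :
  (forall M, exists2 L : R, 0 <= L & forall x y, `|x| <= M -> `|y| <= M ->
    `|f x - f y| <= L * `|x - y|) ->
  {ae mu, forall x : R, derivable f x 1}.
Proof.
move=> lipf.
have : {ae mu, forall x, forall k : nat, - k%:R < x < k%:R -> derivable f x 1}.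
  apply: ae_foralln => k; have [L L0 fL] := lipf k%:R.
  exact: ae_derivable_itv L0 fL.
apply: filterS; first exact: (ae_filter_ringOfSetsType mu).
move=> x h; apply: (h (Num.bound `|x|)).
by rewrite -ltr_norml archi_boundP.
Qed.

End lipschitz_ae_derivable.

(** * Measurability of derivability sets and of directional derivatives *)

Section derivable_borel.
Context {R : realType}.

Let near_rat (q : R -> R) (h a c d : R) : {for h, continuous q} ->
  0 < `|h| < d -> c < `|a - q h| ->
  exists2 r : rat, 0 < `|ratr r : R| < d & c < `|a - q (ratr r)|.
Proof.
move=> cq /andP[h0 hd] hlt.
have e0 : 0 < `|a - q h| - c by rewrite subr_gt0.
have cq' : q y @[y --> h] --> q h := cq.
have /(_ (nbhs_filter h))[d1 /= d10 hd1] := (@cvgrPdist_lt _ _ _ _ _ _ _).1 cq' _ e0.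
(* The three bounds preserve the strict inequality, keep the rational away from 0, and keep it
   within distance d of 0. *)
pose d' := Num.min d1 (Num.min `|h| (d - `|h|)).
have d'0 : 0 < d' by rewrite !lt_min d10 h0 subr_gt0.
have [r] : exists r : rat, ratr r \in `]h, h + d'[.
  by apply: rat_in_itvoo; rewrite ltrDl.
rewrite in_itv/= => /andP[hr rh].
have hrd : `|h - ratr r| < d' by rewrite distrC ger0_norm ?subr_ge0 ?(ltW hr)// ltrBlDl.
move: hrd; rewrite !lt_min => /and3P[hr1 hr2 hr3].
exists r; first (apply/andP; split).
- rewrite normr_gt0; apply: contraTneq hr2 => ->; by rewrite subr0 ltxx.
- rewrite -[ratr r](subrK h) addrC (le_lt_trans (ler_normD _ _))//.
  by rewrite -ltrBrDl distrC.
have /= h1 := hd1 _ hr1.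
have h2 : `|a - q h| <= `|a - q (ratr r)| + `|q h - q (ratr r)|.
  rewrite (_ : a - q h = (a - q (ratr r)) - (q h - q (ratr r))) ?ler_normB//; ring.
lra.
Qed.

(* Countably many conditions, so that the set of points of derivability of a
   continuous function is a Borel set. *)
Lemma cvg_dnbhs0_ratP (q : R -> R) : (forall h, h != 0 -> {for h, continuous q}) ->
  cvg (q h @[h --> 0^']) <->
  forall k : nat, exists m : nat, forall r : rat, 0 < `|ratr r : R| < m.+1%:R^-1 ->
    `|q (ratr r) - q m.+2%:R^-1| <= k.+1%:R^-1.
Proof.
move=> cq; split=> [/cvg_ex[/= l ql] k|H].
  have k0 : 0 < (2 * k.+1%:R)^-1 :> R by rewrite invr_gt0 mulr_gt0.
  have /cvgrPdist_le/(_ _ k0)[d /= d0 hd] := ql.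
  have [m hm] : exists m : nat, m.+1%:R^-1 < d.
    by have [m _ hm] := near_infty_natSinv_lt (PosNum d0); exists m; exact: (hm m (leqnn _)).
  exists m => r /andP[r0 rm].
  have hr : `|l - q (ratr r)| <= (2 * k.+1%:R)^-1.
    apply: hd; last by rewrite -normr_gt0.
    by rewrite /= sub0r normrN (lt_trans rm).
  (* The reference point 1 / (m + 2) lies strictly inside the punctured ball of radius 1 / (m +
     1). *)
  have hm' : `|l - q m.+2%:R^-1| <= (2 * k.+1%:R)^-1.
    apply: hd; last by rewrite /= invr_eq0 pnatr_eq0.
    rewrite /= sub0r normrN ger0_norm ?invr_ge0// (lt_trans _ hm)//.
    by rewrite ltf_pV2 ?posrE// ltr_nat.
  rewrite (_ : _ - _ = (l - q m.+2%:R^-1) - (l - q (ratr r))); last by ring.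
  apply: (le_trans (ler_normB _ _)).
  apply: (le_trans (lerD hm' hr)).
  have half (K : R) : K != 0 -> (2 * K)^-1 + (2 * K)^-1 = K^-1.
    by move=> K0; field.
  by rewrite half ?pnatr_eq0.
apply/cauchy_cvgP/cauchy_exP => e e0.
have [k hk] : exists k : nat, k.+1%:R^-1 < e.
  by have [k _ hk] := near_infty_natSinv_lt (PosNum e0); exists k; exact: (hk k (leqnn _)).
have [m hm] := H k; exists (q m.+2%:R^-1).
suff : \forall h \near 0^', ball (q m.+2%:R^-1) e (q h) by [].
near=> h.
have h0 : h != 0 by near: h; exact: nbhs_dnbhs_neq.
have hm1 : `|h| < m.+1%:R^-1 by near: h; apply: dnbhs0_lt; rewrite invr_gt0.
rewrite /ball /= (le_lt_trans _ hk)// leNgt; apply/negP => hlt.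
have h0' : 0 < `|h| < m.+1%:R^-1 by rewrite normr_gt0 h0.
have [r /hm] := near_rat (cq _ h0) h0' hlt.
by rewrite distrC => h1 h2; have := lt_le_trans h2 h1; rewrite ltxx.
Unshelve. all: by end_near. Qed.

End derivable_borel.

Section derivative_measurable.
Context {R : realType}.

Lemma cvg_difference_quotient (V : normedModType R) (f : V -> R) (x v : V) :
  derivable f x v ->
  m.+1%:R^-1^-1 * (f (m.+1%:R^-1 *: v + x) - f x) @[m --> \oo] --> 'D_v f x.
Proof.
move=> df.
have /cvgr_dnbhsP := df; apply; split=> [m|].
  by rewrite invr_eq0 pnatr_eq0.
exact: cvg_harmonic.
Qed.

Lemma lipschitz_continuous1 (f : R -> R) :
  (forall M, exists2 L : R, 0 <= L & forall x y, `|x| <= M -> `|y| <= M ->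
    `|f x - f y| <= L * `|x - y|) -> continuous f.
Proof.
move=> lipf x; have [L L0 hL] := lipf (`|x| + 1).
have L1 : 0 < L + 1 by rewrite ltr_wpDl.
apply/cvgrPdist_le => e e0.
have d0 : 0 < Num.min 1 (e / (L + 1)) by rewrite lt_min ltr01 divr_gt0.
exists (Num.min 1 (e / (L + 1))) => //= y; rewrite /ball_/= lt_min => /andP[xy1 xy2].
apply: (le_trans (hL _ _ _ _)).
- by rewrite lerDl.
- rewrite -[y](subrK x) addrC (le_trans (ler_normD _ _))// lerD2l distrC.
  exact: ltW.
apply: (@le_trans _ _ ((L + 1) * `|x - y|)); first by rewrite ler_wpM2r// lerDl.
by rewrite mulrC -ler_pdivlMr// ltW.
Qed.

Context {n : nat} (J : 'rV[R]_n -> R).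
Hypothesis lipJ : lipschitz_on_balls J.
Local Notation Rn := (n.-tuple (measurableTypeR R)).

Lemma lipschitz_line (x v : 'rV[R]_n) (M : R) : exists2 L : R, 0 <= L &
  forall s t : R, `|s| <= M -> `|t| <= M ->
    `|J (s *: v + x) - J (t *: v + x)| <= L * `|s - t|.
Proof.
have [L L0 hL] := lipJ (M * `|v| + `|x|).
exists (L * `|v|) => [|s t sM tM]; first exact: mulr_ge0.
have vM (r : R) : `|r| <= M -> `|r *: v + x| <= M * `|v| + `|x|.
  by move=> rM; rewrite (le_trans (ler_normD _ _))// lerD2r normrZ ler_wpM2r.
apply: (le_trans (hL _ _ (vM _ sM) (vM _ tM))).
by rewrite opprD addrACA subrr addr0 -scalerBl normrZ -mulrA [`|v| * _]mulrC.
Qed.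

Variable v : 'rV[R]_n.

Let q (x : 'rV[R]_n) (h : R) : R := h^-1 * (J (h *: v + x) - J x).

Let continuous_q x h : h != 0 -> {for h, continuous (q x)}.
Proof.
move=> h0; have cJ := lipschitz_continuous1 (lipschitz_line x v).
apply: cvgM; first exact: inv_continuous.
by apply: cvgB; [exact: cJ|exact: cvg_cst].
Qed.

Let derivable_q x : derivable J x v <-> cvg (q x h @[h --> 0^']).
Proof. by []. Qed.

Let measurable_q h : measurable_fun [set: Rn] (fun u => q (rV_of_tuple u) h).
Proof.
apply: measurable_funM; first exact: measurable_cst.
apply: measurable_funB; last exact: measurable_lipschitz.
have := measurable_lipschitz (lipschitz_on_balls_affine 1 (h *: v) lipJ).
by under eq_fun do rewrite scale1r.
Qed.

Lemma measurable_derivable : measurable [set u : Rn | derivable J (rV_of_tuple u) v].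
Proof.
pose A k m (r : rat) := [set u : Rn | 0 < `|ratr r : R| < m.+1%:R^-1 ->
  `|q (rV_of_tuple u) (ratr r) - q (rV_of_tuple u) m.+2%:R^-1| <= k.+1%:R^-1].
rewrite (_ : [set _ | _] = \bigcap_k \bigcup_m ~` \bigcup_r ~` A k m r); last first.
  apply/seteqP; split=> u /=.
    move/derivable_q/cvg_dnbhs0_ratP => h k _.
    have [m hm] := h (@continuous_q _) k.
    by exists m => //; rewrite setC_bigcup => r _; rewrite setCK; exact: hm.
  move=> h; apply/derivable_q/cvg_dnbhs0_ratP => [|k]; first exact: continuous_q.
  have [m _] := h k Logic.I; rewrite setC_bigcup => hm; exists m => r.
  by have := hm r Logic.I; rewrite setCK.
apply: bigcapT_measurable => k; apply: bigcupT_measurable => m.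
apply: measurableC; apply: bigcupT_measurable_rat => r; apply: measurableC.
(* The condition on r does not involve u, so the set is either everything or the preimage of a
   closed half-line. *)
rewrite /A; case: (boolP (0 < `|ratr r : R| < m.+1%:R^-1)) => [_|_]; last first.
  by rewrite (_ : [set _ | _] = setT)//; apply/seteqP; split.
rewrite (_ : [set _ | _] = (fun u : Rn => `|q (rV_of_tuple u) (ratr r) -
    q (rV_of_tuple u) m.+2%:R^-1|) @^-1` `]-oo, k.+1%:R^-1]%classic); last first.
  by apply/seteqP; split=> u /=; rewrite in_itv/=; [apply|move=> + _].
rewrite -[X in measurable X]setTI.
apply: (measurableT_comp (@normr_measurable R setT)) => //.
exact: measurable_funB.
Qed.

Lemma measurable_derive :
  measurable_fun [set: Rn] (fun u => 'D_v J (rV_of_tuple u)).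
Proof.
pose D := [set u : Rn | derivable J (rV_of_tuple u) v].
have mD := measurable_derivable.
(* Off [D] the default value of the derivative is 0, which is the limit that the indicator
   enforces. *)
apply: (@measurable_fun_cvg _ _ _ _
  (fun (m : nat) u => \1_D u * q (rV_of_tuple u) m.+1%:R^-1)).
  by move=> m; apply: measurable_funM => //; exact: measurable_indic.
move=> u _; rewrite /= indicE.
have [uD|uD] := boolP (u \in D).
  under eq_cvg do rewrite mul1r.
  move: uD; rewrite inE => /= du.
  exact: cvg_difference_quotient.
under eq_cvg do rewrite mul0r.
rewrite /derive dvgP; first exact: cvg_cst.
by move=> du; move/negP: uD; apply; rewrite inE.
Qed.

End derivative_measurable.

(** * Partial derivatives exist almost everywhere *)

Section null_lines.
Context {R : realType}.
Local Notation mu := (@lebesgue_measure R).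
Local Notation Rn n := (n.-tuple (measurableTypeR R)).

Definition replace_coord n (i : 'I_n) (t : measurableTypeR R) (u : Rn n) : Rn n :=
  [tuple (if j == i then t else tnth u j) | j < n].

Lemma replace_coord_cons0 n (t x : measurableTypeR R) (u : Rn n) :
  replace_coord ord0 t (tuple_cons (x, u)) = tuple_cons (t, u).
Proof.
apply: eq_from_tnth => j; rewrite tnth_mktuple.
by case: (unliftP ord0 j) => [k|] ->; rewrite ?tnthS ?tnth0.
Qed.

Lemma replace_coord_cons_lift n (i : 'I_n) (t x : measurableTypeR R) (u : Rn n) :
  replace_coord (lift ord0 i) t (tuple_cons (x, u)) =
  tuple_cons (x, replace_coord i t u).
Proof.
apply: eq_from_tnth => j; rewrite tnth_mktuple.
case: (unliftP ord0 j) => [k|] ->; rewrite ?tnthS ?tnth0//.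
by rewrite tnth_mktuple (inj_eq lift_inj).
Qed.

Lemma measurable_tuple_cons_section n (A : set (Rn n.+1)) (x : measurableTypeR R) :
  measurable A -> measurable [set u : Rn n | A (tuple_cons (x, u))].
Proof.
move=> mA.
have m : measurable_fun [set: Rn n] (fun u => tuple_cons (x, u)).
  by apply: (measurableT_comp (@measurable_tuple_cons R n)); exact: measurable_pair1.
by have := m measurableT A mA; rewrite setTI.
Qed.

(** Fubini along coordinate i. If i is the first coordinate it is integrated innermost, hence the
    swapped form; otherwise the first coordinate is frozen and the induction applies to the
    section. *)
Lemma lebesgue_tuple_null_lines n (i : 'I_n) (A : set (Rn n)) : measurable A ->
  (forall u, mu [set t | A (replace_coord i t u)] = 0%E) ->
  lebesgue_tuple R n A = 0%E.
Proof.
elim: n i A => [[] //|n IH] i A mA A0.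
have mI : measurable_fun [set: Rn n.+1] (fun u => (\1_A u)%:E : \bar R).
  by apply/measurable_EFinP; exact: measurable_indic.
have -> : lebesgue_tuple R n.+1 A = (\int[lebesgue_tuple R n.+1]_u (\1_A u)%:E)%E.
  by rewrite integral_indic// setIT.
have [j ij|i0] := unliftP ord0 i.
  rewrite ge0_integral_lebesgue_tupleS//.
  apply: integral0_eq => x _.
  pose B := [set u : Rn n | A (tuple_cons (x, u))].
  have mB : measurable B by exact: measurable_tuple_cons_section.
  transitivity (\int[lebesgue_tuple R n]_u (\1_B u)%:E)%E; first by [].
  rewrite integral_indic// setIT; apply: (IH j) => // u.
  rewrite -[RHS](A0 (tuple_cons (x, u))); congr (mu _).
  by apply/seteqP; split=> t /=; rewrite ij replace_coord_cons_lift.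
rewrite ge0_integral_lebesgue_tupleS_swap//.
apply: integral0_eq => u _.
pose B := [set x : measurableTypeR R | A (tuple_cons (x, u))].
have mB : measurable B.
  have m : measurable_fun setT (fun x : measurableTypeR R => tuple_cons (x, u)).
    by apply: (measurableT_comp (@measurable_tuple_cons R n)); exact: measurable_pair2.
  by have := m measurableT A mA; rewrite setTI.
transitivity (\int[mu]_x (\1_B x)%:E)%E; first by [].
rewrite integral_indic// setIT -[RHS](A0 (tuple_cons (0 : R, u))); congr (mu _).
by apply/seteqP; split=> t /=; rewrite i0 replace_coord_cons0.
Qed.

Lemma measurable_replace_coord n (i : 'I_n) (u : Rn n) :
  measurable_fun setT (fun t => replace_coord i t u).
Proof.
apply/measurable_fun_tnthP => j; rewrite /comp.
under eq_fun do rewrite tnth_mktuple.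
by case: (j == i); [exact: measurable_id|exact: measurable_cst].
Qed.

Lemma ae_derivable_coord n (J : 'rV[R]_n -> R) (i : 'I_n) : lipschitz_on_balls J ->
  {ae lebesgue_tuple R n, forall u, derivable J (rV_of_tuple u) (unit_vec R i)}.
Proof.
move=> lipJ; have mD := measurable_derivable lipJ (unit_vec R i).
rewrite /almost_everywhere; apply/negligibleP; first exact: measurableC.
apply: (lebesgue_tuple_null_lines (i := i)) => [|u]; first exact: measurableC.
set B := [set t | _].
have mB : measurable B.
  have := measurable_replace_coord i u measurableT (measurableC mD).
  by rewrite setTI.
apply/negligibleP => //.
(* Setting coordinate i to 0 in the base point makes t both the parameter of the line and its i-th
   coordinate. *)
pose x0 := rV_of_tuple (replace_coord i 0 u).
have xE (t : R) : rV_of_tuple (replace_coord i t u) = t *: unit_vec R i + x0.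
  apply/rowP => j; rewrite !mxE !tnth_mktuple eqxx/=.
  by case: eqP => _; rewrite ?mulr1 ?addr0// mulr0 add0r.
have E (t : R) : derivable J (rV_of_tuple (replace_coord i t u)) (unit_vec R i) =
    derivable (fun t : R => J (t *: unit_vec R i + x0)) t 1.
  rewrite xE /derivable; set g1 := fun h => _; set g2 := fun h => _.
  suff -> : g1 = g2 by [].
  by apply/funext => h; rewrite /g1 /g2 /= [h%:A]mulr1 scalerDl addrA.
have := lipschitz_ae_derivable (lipschitz_line lipJ x0 (unit_vec R i)).
rewrite /almost_everywhere; congr (_.-negligible _).
by apply/seteqP; split=> t; rewrite /B /= E.
Qed.

Lemma ae_derivable n (J : 'rV[R]_n -> R) : lipschitz_on_balls J ->
  {ae lebesgue_tuple R n, forall u, forall i, derivable J (rV_of_tuple u) (unit_vec R i)}.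
Proof.
move=> lipJ.
(* The countable intersection is indexed by [nat], so indices outside ['I_n] get a trivial
   condition. *)
have : {ae lebesgue_tuple R n, forall u, forall k : nat,
    if insub k is Some i then derivable J (rV_of_tuple u) (unit_vec R i) else True}.
  apply: ae_foralln => k; case: insubP => [i _ _|_]; first exact: ae_derivable_coord.
  exact: aeW.
apply: negligibleS => u /= hu hk; apply: hu => i.
by have := hk i; rewrite valK.
Qed.

End null_lines.

(** * Directional derivatives under affine changes of variable *)

Section affine_derivative.
Context {R : realType} {n : nat}.
Implicit Types (f : 'rV[R]_n -> R) (z u v : 'rV[R]_n) (a : R).

Let affine_quotient f z u v a l : a != 0 ->
  h^-1 *: ((f \o shift (z + a *: u)) (h *: v) - f (z + a *: u)) @[h --> 0^'] --> l ->
  h^-1 *: (((fun y => f (z + a *: y)) \o shift u) (h *: v) - f (z + a *: u))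
    @[h --> 0^'] --> a * l.
Proof.
move=> a0 fl; apply/cvgr_dnbhsP => s [s0 scvg].
have /cvgr_dnbhsP/(_ (fun k => a * s k)) := fl.
have as0 : (forall k, a * s k != 0) /\ a * s k @[k --> \oo] --> (0 : R).
  split=> [k|]; first by rewrite mulf_neq0.
  by rewrite -[X in _ --> X](mulr0 a); apply: cvgM => //; exact: cvg_cst.
move=> /(_ as0) H.
have -> : (fun k => (s k)^-1 *: (((fun y => f (z + a *: y)) \o shift u) (s k *: v) -
      f (z + a *: u))) =
    (fun k => a * ((a * s k)^-1 *: ((f \o shift (z + a *: u)) ((a * s k) *: v) -
      f (z + a *: u)))).
  apply/funext => k; rewrite /= [z + _]addrC [a *: (_ + _)]scalerDr scalerA -addrA [_ + z]addrC.
  by rewrite [RHS]mulrA invfM mulrA divff// mul1r.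
exact: (cvgM (cvg_cst a) H).
Qed.

(** One implication suffices for both directions: the converse is that implication for the inverse
    affine map. *)
Lemma derivable_affine f z u v a : a != 0 ->
  derivable (fun y => f (z + a *: y)) u v <-> derivable f (z + a *: u) v.
Proof.
have half (g : 'rV[R]_n -> R) x y b : b != 0 -> derivable g (x + b *: y) v ->
    derivable (fun y => g (x + b *: y)) y v.
  move=> b0 /cvg_ex[/= l hl]; apply/cvg_ex; exists (b * l).
  exact: (affine_quotient b0 hl).
move=> a0; split=> [df|]; last exact: half.
pose g y := f (z + a *: y).
have fE y : f y = g (- (a^-1 *: z) + a^-1 *: y).
  by rewrite /g scalerDr scalerN !scalerA divff// !scale1r addNKr.
have -> : f = fun y => g (- (a^-1 *: z) + a^-1 *: y) by exact/funext.
apply: half; first by rewrite invr_neq0.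
by rewrite scalerDr scalerA mulVf// scale1r addKr.
Qed.

(** The identity also holds where the derivative does not exist, since both sides then take the
    default value 0. *)
Lemma derive_affine f z u v a : a != 0 ->
  'D_v (fun y => f (z + a *: y)) u = a * 'D_v f (z + a *: u).
Proof.
move=> a0; have [df|ndf] := pselect (derivable f (z + a *: u) v).
  by apply/cvg_lim => //; exact: (affine_quotient a0 df).
rewrite /derive dvgP; last by move/(derivable_affine f z u v a0).
by rewrite dvgP// mulr0.
Qed.

End affine_derivative.

(** * Difference quotients of J_a converge to the smoothed gradient *)

Section integral_of_gradient.
Context {R : realType} {n : nat} (J : 'rV[R]_n -> R) (a : R) (z : 'rV[R]_n) (i : 'I_n).
Hypotheses (lipJ : lipschitz_on_balls J) (a_gt0 : 0 < a).
Local Notation Rn := (n.-tuple (measurableTypeR R)).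
Local Notation e := (unit_vec R i).

Lemma integral_grad_kappa :
  (lebesgue_tuple R n).-integrable (@cube R n)
    (fun u : Rn => (grad J (z + a *: rV_of_tuple u) 0 i * kappa (rV_of_tuple u))%:E) /\
  m.+1%:R^-1^-1 * (Ja J a (m.+1%:R^-1 *: e + z) - Ja J a z) @[m --> \oo] -->
  smoothed_grad J a z 0 i.
Proof.
have a0 : a != 0 by rewrite gt_eqF.
have mc := @measurable_cube R n.
(* Almost everywhere derivability is applied to [J'] in the variable u, so no null set has to be
   moved by the map u -> z + a u. *)
pose J' y := J (z + a *: y).
have lipJ' : lipschitz_on_balls J' := lipschitz_on_balls_affine a z lipJ.
pose Q (m : nat) (u : Rn) : R := m.+1%:R^-1^-1 *
  (J ((m.+1%:R^-1 *: e + z) + a *: rV_of_tuple u) - J (z + a *: rV_of_tuple u)).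
have intJ y := integrable_lipschitz_kappa a y lipJ.
have QE m u : Q m u * kappa (rV_of_tuple u) = m.+1%:R^-1^-1 *
   (J ((m.+1%:R^-1 *: e + z) + a *: rV_of_tuple u) * kappa (rV_of_tuple u) -
    J (z + a *: rV_of_tuple u) * kappa (rV_of_tuple u)).
  by rewrite /Q -mulrA [in LHS]mulrBl.
have intB m : (lebesgue_tuple R n).-integrable (@cube R n) (fun u : Rn =>
   (J ((m.+1%:R^-1 *: e + z) + a *: rV_of_tuple u) * kappa (rV_of_tuple u) -
    J (z + a *: rV_of_tuple u) * kappa (rV_of_tuple u))%:E).
  by under eq_fun do rewrite EFinB; exact: integrableB.
have intQ m : (lebesgue_tuple R n).-integrable (@cube R n)
    (fun u : Rn => (Q m u * kappa (rV_of_tuple u))%:E).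
  by under eq_fun do rewrite QE EFinM; exact: integrableZl.
have QJa m : \int[lebesgue_tuple R n]_(u in @cube R n) (Q m u * kappa (rV_of_tuple u)) =
    m.+1%:R^-1^-1 * (Ja J a (m.+1%:R^-1 *: e + z) - Ja J a z).
  under eq_Rintegral do rewrite QE.
  rewrite (RintegralZl _ mc (intB m)); congr (_ * _).
  exact: (RintegralB mc (intJ _) (intJ _)).
(* This radius covers all shifted points, because the increments 1 / (m + 1) are at most 1;
   [L * kappa] is then the dominating function. *)
have [L L0 hL] := lipJ (1 + `|z| + a).
have e1 : `|e| <= 1.
  by apply: mx_norm_le => // j; rewrite !mxE eqxx /=; case: (j == i); rewrite ?normr1 ?normr0.
have QL m u : @cube R n u -> `|Q m u| <= L.
  move=> uc.
  have m0 : 0 < m.+1%:R^-1 :> R by rewrite invr_gt0.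
  rewrite /Q normrM gtr0_norm ?invr_gt0// mulrC ler_pdivrMr//.
  have m1 : m.+1%:R^-1 <= 1 :> R by rewrite invf_le1// ler1n.
  apply: (le_trans (hL _ _ _ _)).
  - apply: norm_affine_cube; [exact: ltW| |exact: cube_norm].
    rewrite (le_trans (ler_normD _ _))// lerD2r normrZ gtr0_norm//.
    by rewrite mulr_ile1// ltW.
  - apply: norm_affine_cube; [exact: ltW| |exact: cube_norm].
    by rewrite lerDr.
  - rewrite opprD addrACA subrr addr0 -addrA subrr addr0 normrZ gtr0_norm//.
    by rewrite ler_wpM2l// ler_piMr// ltW.
have mgrad : measurable_fun [set: Rn] (fun u => grad J (z + a *: rV_of_tuple u) 0 i).
  have := measurable_derive lipJ' e.
  have -> : (fun u : Rn => grad J (z + a *: rV_of_tuple u) 0 i) =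
      (fun u => a^-1 * 'D_e J' (rV_of_tuple u)).
    by apply/funext => u; rewrite mxE derive_affine// mulKf.
  by move=> ?; apply: measurable_funM => //; exact: measurable_cst.
have mkappa : measurable_fun (@cube R n) (fun u : Rn => kappa (rV_of_tuple u)).
  by have /measurable_int/measurable_EFinP := @integrable_kappa R n.
have [] := @dominated_convergence _ _ _ (lebesgue_tuple R n) _ mc
  (fun m u => (Q m u * kappa (rV_of_tuple u))%:E)
  (fun u => (grad J (z + a *: rV_of_tuple u) 0 i * kappa (rV_of_tuple u))%:E)
  (fun u => (L * kappa (rV_of_tuple u))%:E).
- by move=> m; have /measurable_int := intQ m.
- apply/measurable_EFinP; apply: measurable_funM => //.
  exact: (measurable_funS measurableT).
- have := ae_derivable lipJ'; apply: negligibleS => u /= + hd; apply => uc.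
  apply: cvg_EFin; first exact: nearW.
  apply: cvgM; last exact: cvg_cst.
  rewrite mxE.
  have := cvg_difference_quotient ((derivable_affine J z (rV_of_tuple u) e a0).1 (hd i)).
  by rewrite /Q; under eq_fun do rewrite addrA.
- exact: (integrableZl mc L integrable_kappa).
- apply: aeW => u m uc; rewrite /= lee_fin normrM (ger0_norm (kappa_ge0 _)).
  by rewrite ler_wpM2r ?kappa_ge0// QL.
move=> int1 _ cv; split=> //.
rewrite mxE /Rintegral.
under eq_fun do rewrite -QJa.
apply: fine_cvg; rewrite fineK; last exact: integrable_fin_num.
exact: cv.
Qed.

End integral_of_gradient.

(** * Assembly of the averaging identity *)

Lemma cvg_rV {R : realType} {n : nat} {T : Type} {F : set_system T} {FF : Filter F}
    (f : T -> 'rV[R]_n) (l : 'rV[R]_n) :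
  (forall i, f t 0 i @[t --> F] --> l 0 i) -> f t @[t --> F] --> l.
Proof.
move=> fl; apply/cvgrPdist_le => e e0.
have H : \forall t \near F, forall i : 'I_n, `|l 0 i - f t 0 i| <= e.
  apply: filter_forall => i; have /cvgrPdist_le := fl i; exact.
apply: filterS H => t ht; apply: mx_norm_le => [|i]; first exact: ltW.
by rewrite !mxE.
Qed.

Theorem mainTheorem3 (R : realType) (n : nat) (J : 'rV[R]_n -> R) (a : R)
    (w : 'rV[R]_n) :
  (0 < n)%N ->
  [locally [lipschitz J x | x in [set: 'rV[R]_n]]] ->
  0 < a ->
  (forall i : 'I_n, 0 < w 0 i) ->
  rationally_independent w ->
  (* the gradient of J exists almost everywhere and its components, weighted
     by kappa, are integrable over every cube z + a [-1, 1]^n *)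
  [/\ {ae lebesgue_tuple R n, forall u,
        forall i : 'I_n, derivable J (rV_of_tuple u) (unit_vec R i)},
      (forall (z : 'rV[R]_n) (i : 'I_n),
        (lebesgue_tuple R n).-integrable (@cube R n) (fun u =>
          (grad J (z + a *: rV_of_tuple u) 0 i * kappa (rV_of_tuple u))%:E)),
      (forall x : 'rV[R]_n, differentiable (Ja J a) x) &
      (forall (z : 'rV[R]_n) (tau0 : R),
        exists Fbar : 'rV[R]_n,
          [/\ time_average J a w z tau0 T @[T --> +oo] --> Fbar,
              Fbar = - smoothed_grad J a z &
              - smoothed_grad J a z = - grad (Ja J a) z])].
Proof.
move=> _ /locally_lipschitz_on_balls lipJ a_gt0 _ w_indep.
(* Differentiability does not mention the start of the window, so the start 0 is taken. *)
have dJa x : differentiable (Ja J a) x.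
  by have [G [_ /(_ x)[]]] := Ja_gradient 0 lipJ a_gt0 w_indep.
split=> [|z i|x|z tau0].
- exact: ae_derivable.
- by have [] := integral_grad_kappa z i lipJ a_gt0.
- exact: dJa.
have [G [meanG gradG]] := Ja_gradient tau0 lipJ a_gt0 w_indep.
have gradE : smoothed_grad J a z = grad (Ja J a) z.
  apply/rowP => i; rewrite [RHS]mxE.
  have [_ cv] := integral_grad_kappa z i lipJ a_gt0.
  have dz : derivable (Ja J a) z (unit_vec R i) by exact: diff_derivable (dJa z).
  (* Both vectors are limits of the same difference quotients of J_a along 1 / (m + 1). *)
  exact: (cvg_unique _ cv (cvg_difference_quotient dz)).
exists (- smoothed_grad J a z); split=> //; last by rewrite gradE.
apply: cvg_rV => i.
have -> : (- smoothed_grad J a z) 0 i = - G i z by rewrite gradE !mxE (gradG z).2.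
have -> : (fun T => time_average J a w z tau0 T 0 i) =
    time_mean tau0 (fun t => esF J a z (t *: w) 0 i) by apply/funext => T; rewrite mxE.
exact: (meanG i z).2.
Qed.
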